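(* Let $f:\mathbb R^d\to\mathbb R$ be twice continuously differentiable and consider the Split-Client cubic iteration described in the context with exact gradients and exact (but delayed) Hessians. Assume: (A1) $\|\nabla^2 f(x)-\nabla^2 f(y)\|\le L\|x-y\|$ for all $x,y$, with $L>0$; (A2) $f(x)\ge f^\star$ for all $x$; (A3) there is $\gamma\ge1$ with $\gamma^{-1}\Delta_i\le\Delta_{i+1}\le\gamma\Delta_i$ for all $i$; (A4) $\tau_k\le\tau_{\max}<\infty$ for all $k$; (A5) $\|H_0-\nabla^2 f(x_0)\|\le\delta_0$. Run the iteration with $\rho_k=20L(1+\tau_k)$ for $T\ge1$ steps and let $x_{\mathrm{out}}$ be sampled from $\{x_1,\dots,x_T\}$, taking $x_{\mathrm{out}}=x_{k+1}$ with probability $p_k\propto(1+\tau_k)^{-1/2}$, $k=0,\dots,T-1$. Let $\bar\tau=\frac1T\sum_{k=0}^{T-1}\tau_k$, $F_0=f(x_0)-f^\star$ and $\widetilde F_0=F_0+\frac{a_1\delta_0^3}{(20L)^2}$. Then: 1. (First-order) $$\mathbb E\big[\|\nabla f(x_{\mathrm{out}})\|^{3/2}\big]\le\frac{8\,L^{1/2}\,\widetilde F_0\,\sqrt{1+\bar\tau}}{T}.$$ 2. (Second-order) There exists $k^\star\in\{0,\dots,T-1\}$ such that $$\lambda_{\min}\big(\nabla^2 f(x_{k^\star+1})\big)\ge-\frac{C\,L^{2/3}\,\widetilde F_0^{1/3}\,(1+\tau_{\max})^{4/3}}{T^{1/3}}$$ for an absolute constant $C\le7$.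
   Context: Two-timeline model: gradient iterations are indexed by integers $k=0,1,2,\dots$, each taking one unit of wall-clock time. Curvature jobs $i=0,1,2,\dots$ run serially on intervals $[a_i,b_i]$ with integer endpoints, $a_0=0$, $a_{i+1}=b_i$, duration $\Delta_i=b_i-a_i\ge1$ (so $a_1=\Delta_0$). Job $i$ reads $x_{a_i}$ at time $a_i$ and at time $b_i$ publishes $\nabla^2 f(x_{a_i})$. The curvature in use at iteration $k$ is $\widetilde H_k=H_0$ (a given symmetric surrogate matrix) if $0\le k<a_1$, and $\widetilde H_k=\nabla^2 f(x_{a_{i-1}})=\nabla^2 f(x_{k-\tau_k})$ if $a_i\le k<b_i$ with $i\ge1$. The delay is $\tau_k=k-a_{i-1}$ for $a_i\le k<b_i$, $i\ge1$, and $\tau_k=k$ for $0\le k<a_1$. Split-Client cubic iteration: from a given $x_0$, $x_{k+1}=x_k+s_k$ with $$s_k\in\arg\min_{s\in\mathbb R^d}\Big\{\langle\nabla f(x_k),s\rangle+\tfrac12\langle\widetilde H_k s,s\rangle+\tfrac{\rho_k}{6}\|s\|^3\Big\}.$$ $\|\cdot\|$ is the Euclidean norm for vectors and the spectral norm for matrices; $\lambda_{\min}$ is the smallest eigenvalue. The expectation is over the random choice of $x_{\mathrm{out}}$. *)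

(* Defs.v *)
From HB Require Import structures.
From mathcomp Require Import all_boot all_order all_algebra.
From mathcomp Require Import all_classical all_reals all_analysis.

Set Implicit Arguments.
Unset Strict Implicit.
Unset Printing Implicit Defensive.

Import Order.TTheory GRing.Theory Num.Theory.
Import numFieldNormedType.Exports.

Local Open Scope classical_set_scope.
Local Open Scope ring_scope.

(* Points of R^d are row vectors, and matrices act on the right, as in the
   library's [jacobian].  The library norm [`|x|] on 'rV[R]_d is the sup norm;
   it induces the usual topology, so the library notions of differentiability
   and continuity apply, but the Euclidean norm has to be defined. *)

Section Euclidean.
Context {R : realType} {d : nat}.

Definition dot (u v : 'rV[R]_d) : R := \sum_i u 0 i * v 0 i.

Definition enorm (u : 'rV[R]_d) : R := Num.sqrt (dot u u).

(* Operator norm for [enorm]. *)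
Definition specnorm (A : 'M[R]_d) : R :=
  sup [set enorm (v *m A) | v in [set v | enorm v <= 1]].

(* For A symmetric and d > 0 the spectrum is finite and nonempty, so that the
   infimum is a minimum. *)
Definition lambda_min (A : 'M[R]_d) : R := inf [set l | eigenvalue A l].

End Euclidean.

Section Derivatives.
Context {R : realType} {d : nat}.
Implicit Type f : 'rV[R]_d -> R.

Definition gradient f (x : 'rV[R]_d) : 'rV[R]_d :=
  \row_j 'D_(delta_mx 0 j) f x.

Definition hessian f (x : 'rV[R]_d) : 'M[R]_d := 'J (gradient f) x.

Definition twice_continuously_differentiable f : Prop :=
  [/\ forall x, differentiable f x,
      forall x, differentiable (gradient f) x
    & continuous (hessian f)].

End Derivatives.

Section CubicStep.
Context {R : realType} {d : nat}.

Definition cubic_model (g : 'rV[R]_d) (H : 'M[R]_d) (rho : R)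
    (s : 'rV[R]_d) : R :=
  dot g s + 1 / 2 * dot (s *m H) s + rho / 6 * enorm s ^+ 3.

Definition argmin (F : 'rV[R]_d -> R) : set 'rV[R]_d :=
  [set s | forall s', F s <= F s'].

End CubicStep.

(* Job i runs on [a i, b i].  Since time starts at a 0 = 0, the integer
   endpoints are natural numbers. *)
Definition timeline (a b : nat -> nat) : Prop :=
  [/\ a 0%N = 0%N, forall i, a i.+1 = b i & forall i, (a i < b i)%N].

Definition duration (a b : nat -> nat) (i : nat) : nat := (b i - a i)%N.

(* For a timeline the intervals [a i, b i[ partition nat, so the next two
   predicates determine [tau] and, given the iterates, [Ht]. *)
Definition is_delay (a b tau : nat -> nat) : Prop :=
  (forall k, (k < a 1)%N -> tau k = k) /\
  (forall i k, (a i.+1 <= k < b i.+1)%N -> tau k = (k - a i)%N).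

Definition is_curvature_in_use {R : realType} {d : nat} (a b : nat -> nat)
    (f : 'rV[R]_d -> R) (H0 : 'M[R]_d) (x : nat -> 'rV[R]_d)
    (Ht : nat -> 'M[R]_d) : Prop :=
  (forall k, (k < a 1)%N -> Ht k = H0) /\
  (forall i k, (a i.+1 <= k < b i.+1)%N -> Ht k = hessian f (x (a i))).

Definition split_client_run {R : realType} {d : nat}
    (f : 'rV[R]_d -> R) (Ht : nat -> 'M[R]_d) (rho : nat -> R) (T : nat)
    (x s : nat -> 'rV[R]_d) : Prop :=
  forall k, (k < T)%N ->
    x k.+1 = x k + s k /\
    argmin (cubic_model (gradient f (x k)) (Ht k) (rho k)) (s k).

Section Sampling.
Context {R : realType}.
Implicit Types (tau : nat -> nat) (T k : nat).

Definition mean_delay tau T : R := (\sum_(k < T) (tau k)%:R) / T%:R.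

Definition weight tau k : R := (1 + (tau k)%:R) `^ (- (1 / 2)).

Definition sampling_proba tau T k : R :=
  weight tau k / \sum_(j < T) weight tau j.

End Sampling.

(* Main.v *)
Require Import Defs.
From HB Require Import structures.
From mathcomp Require Import all_boot all_order all_algebra ring lra.
From mathcomp Require Import all_classical all_reals all_analysis.
From mathcomp Require Import measurable_realfun.

Import Order.TTheory GRing.Theory Num.Theory.
Import numFieldNormedType.Exports.

Local Open Scope classical_set_scope.
Local Open Scope ring_scope.

(** Write n = 1 + tau_k, r = |s_k|, G = grad f(x_{k+1}), and let L E bound the
    error of the Hessian in use at x_k.

    One step.  The global minimizer s of the cubic model satisfies
    grad f(x_k) + s H + 10 L n r s = 0 and H + 10 L n r I >= 0; hence
    <grad f(x_k), s> <= 0, and G = - 10 L n r s + w with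
    |w| <= L (E + r / 2) r.  The trapezoid rule, whose error is L r^3 / 12 when
    the Hessian is L-Lipschitz, then bounds the decrease q_k = f(x_k) -
    f(x_{k+1}) below by - <G, s> / 2 - L r^3 / 12.  Expanding |w|^2 turns
    - <G, s> into |G|^2 + (10 L n r^2)^2 - |w|^2 up to the factor 20 L n r, and
    the arithmetic-geometric inequality turns |G|^2 into the power 3/2:

      n^(-1/2) |G|^(3/2) <= sqrt L (8 q_k + L Y_k),
      Y_k = (E + r / 2)^2 r / (5 n) + 2 r^3 / 3 - 6.816 n r^3.

    Working with - <G, s> is what makes the constant 8 reachable: bounding the
    decrease and |G| separately would pay for the Hessian error twice.

    Stale Hessians.  E is at most the length S of the path travelled since the
    Hessian was read, plus delta0 / L while H_0 is in use.  What has to be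
    shown is that the errors S are paid for by the terms n r^3, and this is a
    weighted Hardy inequality (the sum of S_p^3 / p^2 is at most a constant times
    the sum of p r_p^3, for the partial sums S_p of r).  It is used in telescoped
    form, through the potential 0.3 S^3 / p of a window, where p is the number
    of iterations since the window was opened and S the length travelled in
    it.  Job i opens window i when it reads; the window is active, and its S is
    the Hessian error, while job i + 1 runs.  An iteration thus sees at most
    two windows, the active one and the next one, and n is at least its rank in
    either, so that the coefficient 6.816 pays for the growth of both
    potentials.  While job 0 runs, a further 0.02 (delta0 / L)^3 per iteration
    pays for delta0; over the a_1 iterations of that job this adds up to the
    last term of Ft_0.

    Conclusion.  Summing Y_k yields a bound 8 sqrt L Ft_0 for the weighted sum
    of |G|^(3/2), and Jensen's inequality for 1 / sqrt bounds the normalization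
    of the weights.  For the curvature, lambda_min at x_{k+1} is at least
    - L (10 n r + E + r); the cubes of these quantities, divided by
    (1 + tau_max)^4, are absorbed by the same potentials, and some k does not
    exceed the mean. *)

(** * Euclidean norm and spectral norm *)

Section EuclideanTheory.
Context {R : realType} {d : nat}.
Implicit Types (u v w : 'rV[R]_d) (A B : 'M[R]_d) (c : R).

Lemma dotE u v : dot u v = (u *m v^T) 0 0.
Proof. by rewrite mxE; apply: eq_bigr => i _; rewrite mxE. Qed.

Lemma dotC u v : dot u v = dot v u.
Proof. by apply: eq_bigr => i _; rewrite mulrC. Qed.

Lemma dotDl u v w : dot (u + v) w = dot u w + dot v w.
Proof. by rewrite !dotE mulmxDl mxE. Qed.

Lemma dotDr u v w : dot u (v + w) = dot u v + dot u w.
Proof. by rewrite !(dotC u) dotDl. Qed.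

Lemma dotZl c u v : dot (c *: u) v = c * dot u v.
Proof. by rewrite !dotE -scalemxAl mxE. Qed.

Lemma dotZr c u v : dot u (c *: v) = c * dot u v.
Proof. by rewrite !(dotC u) dotZl. Qed.

Lemma dotNl u v : dot (- u) v = - dot u v.
Proof. by rewrite -scaleN1r dotZl mulN1r. Qed.

Lemma dotNr u v : dot u (- v) = - dot u v.
Proof. by rewrite !(dotC u) dotNl. Qed.

Lemma dot0l u : dot 0 u = 0.
Proof. by rewrite -(scale0r 0) dotZl mul0r. Qed.

Lemma dot0r u : dot u 0 = 0.
Proof. by rewrite dotC dot0l. Qed.

Definition dot_linE := (dotDl, dotDr, dotNl, dotNr, dotZl, dotZr).

Lemma dot_sym A u v : A^T = A -> dot (u *m A) v = dot u (v *m A).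
Proof. by move=> sA; rewrite !dotE trmx_mul sA mulmxA. Qed.

Lemma dot_ge0 u : 0 <= dot u u.
Proof. by apply: sumr_ge0 => i _; rewrite -expr2 sqr_ge0. Qed.

Lemma enorm_ge0 u : 0 <= enorm u.
Proof. exact: sqrtr_ge0. Qed.

Lemma enorm_sqr u : enorm u ^+ 2 = dot u u.
Proof. by rewrite sqr_sqrtr // dot_ge0. Qed.

Lemma enorm0 : enorm (0 : 'rV[R]_d) = 0.
Proof. by rewrite /enorm dot0l sqrtr0. Qed.

Lemma dot_eq0 u : dot u u = 0 -> u = 0.
Proof.
move=> /eqP; rewrite psumr_eq0 => [/allP u0|i _]; last by rewrite -expr2 sqr_ge0.
apply/rowP => i; rewrite mxE; apply/eqP.
by have := u0 i (mem_index_enum _); rewrite -expr2 sqrf_eq0.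
Qed.

Lemma enorm_eq0 u : enorm u = 0 -> u = 0.
Proof. by move=> u0; apply: dot_eq0; rewrite -enorm_sqr u0 expr0n. Qed.

Lemma enormZ c u : enorm (c *: u) = `|c| * enorm u.
Proof.
by rewrite /enorm dotZl dotZr mulrA -expr2 sqrtrM ?sqr_ge0 // sqrtr_sqr.
Qed.

Lemma enormN u : enorm (- u) = enorm u.
Proof. by rewrite -scaleN1r enormZ normrN1 mul1r. Qed.

Lemma dot_le u v : dot u v <= enorm u * enorm v.
Proof.
have [v0|v0] := eqVneq (enorm v) 0.
  by rewrite (enorm_eq0 _ v0) dot0r enorm0 mulr0.
have [u0|u0] := eqVneq (enorm u) 0.
  by rewrite (enorm_eq0 _ u0) dot0l enorm0 mul0r.
have uv0 : 0 < enorm u * enorm v.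
  by rewrite mulr_gt0 // lt_neqAle eq_sym enorm_ge0 ?u0 ?v0.
have := dot_ge0 (enorm v *: u - enorm u *: v).
rewrite !dot_linE (dotC v u) -!enorm_sqr => H.
rewrite -(ler_pM2l uv0); nra.
Qed.

Lemma dot_ge u v : - (enorm u * enorm v) <= dot u v.
Proof. by rewrite lerNl -dotNl -(enormN u) dot_le. Qed.

Lemma enormD u v : enorm (u + v) <= enorm u + enorm v.
Proof.
rewrite -(@ler_pXn2r _ 2) ?nnegrE ?addr_ge0 ?enorm_ge0 //.
rewrite enorm_sqr !dot_linE (dotC v u) sqrrD !enorm_sqr.
have := dot_le u v; lra.
Qed.

Lemma enormB u v : enorm (u - v) = enorm (v - u).
Proof. by rewrite -enormN opprB. Qed.

(** Testing against [u] itself. *)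
Lemma enorm_le_dual u c : 0 <= c -> (forall v, dot u v <= c * enorm v) ->
  enorm u <= c.
Proof.
move=> c0 /(_ u); rewrite -enorm_sqr expr2.
have [->//|u0] := eqVneq (enorm u) 0.
by rewrite ler_pM2r // lt_neqAle eq_sym u0 enorm_ge0.
Qed.

(** The Frobenius norm bounds the set whose supremum is [specnorm], so that this
    supremum is not a junk value. *)
Lemma enorm_mulmx_bounded A : exists2 c, 0 <= c &
  forall v, enorm (v *m A) <= c * enorm v.
Proof.
pose c2 := \sum_j dot (col j A)^T (col j A)^T.
have c20 : 0 <= c2 by apply: sumr_ge0 => j _; exact: dot_ge0.
exists (Num.sqrt c2); first exact: sqrtr_ge0.
move=> v; rewrite -(@ler_pXn2r _ 2) ?nnegrE ?mulr_ge0 ?enorm_ge0 ?sqrtr_ge0 //.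
rewrite exprMn (@sqr_sqrtr _ c2) // !enorm_sqr mulr_suml ler_sum // => j _.
have -> : (v *m A) 0 j = dot v (col j A)^T.
  by rewrite mxE; apply: eq_bigr => i _; rewrite !mxE.
rewrite -!enorm_sqr -expr2 -exprMn -[X in X <= _]real_normK ?num_real //.
rewrite lerXn2r ?nnegrE ?mulr_ge0 ?enorm_ge0 //.
by rewrite ler_norml mulrC dot_le dot_ge.
Qed.

Lemma specnorm_ub A v : enorm v <= 1 -> enorm (v *m A) <= specnorm A.
Proof.
move=> v1; apply: ub_le_sup; last by exists v.
have [c c0 Hc] := enorm_mulmx_bounded A; exists c => _ [w /= w1 <-].
by apply: le_trans (Hc w) _; rewrite ler_piMr.
Qed.

Lemma specnorm_ge0 A : 0 <= specnorm A.
Proof. by apply: le_trans (@specnorm_ub A 0 _); rewrite ?enorm0 ?ler01 ?enorm_ge0. Qed.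

Lemma specnorm_le A v : enorm (v *m A) <= specnorm A * enorm v.
Proof.
have [v0|v0] := eqVneq (enorm v) 0.
  by rewrite (enorm_eq0 v v0) mul0mx enorm0 mulr0.
have v1 : 0 < enorm v by rewrite lt_neqAle eq_sym v0 enorm_ge0.
have := @specnorm_ub A ((enorm v)^-1 *: v).
rewrite -scalemxAl !enormZ ger0_norm ?invr_ge0 ?enorm_ge0 // mulVf // => /(_ (lexx _)).
by rewrite mulrC ler_pdivrMr.
Qed.
End EuclideanTheory.

(** * Global minimizers of the cubic model *)

Section CubicModel.
Context {R : realType} {d : nat}.
Implicit Types (g s u v w : 'rV[R]_d) (H : 'M[R]_d) (rho : R).

Lemma slope_ge0_eq0 (l C : R) : 0 <= l -> 0 <= C ->
  (forall t, `|t| <= 1 -> 0 <= t * l + t ^+ 2 * C) -> l = 0.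
Proof.
move=> l0 C0 h; apply/eqP; rewrite eq_le l0 andbT leNgt; apply/negP => lp.
have D0 : 0 < 2 * (C + l) by lra.
have := h (- (l / (2 * (C + l)))).
have t0 : 0 <= l / (2 * (C + l)) by rewrite divr_ge0 //; lra.
rewrite normrN ger0_norm // ler_pdivrMr // => /(_ ltac:(lra)).
have e : l / (2 * (C + l)) * (2 * (C + l)) = l by rewrite divfK // gt_eqF.
have tp : 0 < l / (2 * (C + l)) by rewrite divr_gt0.
move: t0 e tp; set t := l / _ => t0 e tp.
have -> : - t * l + (- t) ^+ 2 * C = t * (t * C - l) by ring.
by rewrite pmulr_rge0 //; nra.
Qed.

Lemma limit_at0_ge0 (q b c : R) :
  (forall t, 0 < t -> 0 <= q + t * b + t ^+ 2 * c) -> 0 <= q.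
Proof.
move=> h; rewrite leNgt; apply/negP => q0.
have D0 : 0 < `|b| + `|c| - 2 * q.
  by have := normr_ge0 b; have := normr_ge0 c; lra.
have tp : 0 < - q / (`|b| + `|c| - 2 * q) by rewrite divr_gt0 // oppr_gt0.
have e : - q / (`|b| + `|c| - 2 * q) * (`|b| + `|c| - 2 * q) = - q.
  by rewrite divfK // gt_eqF.
have := h _ tp; move: e tp; set t := - q / _ => e tp.
have t1 : t < 1 by have := normr_ge0 b; have := normr_ge0 c; nra.
have b1 : t * b <= t * `|b| by rewrite ler_pM2l // ler_norm.
have c1 : t ^+ 2 * c <= t * `|c|.
  apply: (@le_trans _ _ (t ^+ 2 * `|c|)).
    by rewrite ler_wpM2l ?sqr_ge0 // ler_norm.
  by rewrite ler_wpM2r // expr2 ler_piMl // ltW.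
by nra.
Qed.

Lemma cubic_modelD g H rho s v : H^T = H ->
  cubic_model g H rho (s + v) = cubic_model g H rho s
    + dot (g + s *m H) v + 1 / 2 * dot (v *m H) v
    + rho / 6 * (enorm (s + v) ^+ 3 - enorm s ^+ 3).
Proof.
move=> sH; have e : dot (v *m H) s = dot (s *m H) v by rewrite dot_sym // dotC.
by rewrite /cubic_model mulmxDl !dot_linE e; field.
Qed.

Lemma argmin_cubic_model g H rho s v : H^T = H ->
  argmin (cubic_model g H rho) s ->
  0 <= dot (g + s *m H) v + 1 / 2 * dot (v *m H) v
       + rho / 6 * (enorm (s + v) ^+ 3 - enorm s ^+ 3).
Proof.
move=> sH /(_ (s + v)); rewrite cubic_modelD //.
by move: (cubic_model g H rho s) => m; lra.
Qed.

(** With z = |s + v| and r = |s|, the right-hand side comes from the identity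
    z^3 = r^3 + 3/2 r (z^2 - r^2) + (z - r)^2 (z + r / 2): the cubed norm is
    expanded to first order without differentiating the norm at 0. *)
Lemma enorm_cube_le s v : enorm (s + v) ^+ 3 <= enorm s ^+ 3
  + 3 / 2 * enorm s * (2 * dot s v + dot v v)
  + enorm v ^+ 2 * (2 * enorm s + enorm v).
Proof.
have zE : enorm (s + v) ^+ 2 = enorm s ^+ 2 + (2 * dot s v + dot v v).
  by rewrite !enorm_sqr !dot_linE (dotC v s); ring.
have z1 := enormD s v.
have z2 : enorm s <= enorm (s + v) + enorm v.
  by have := enormD (s + v) (- v); rewrite addrK enormN.
have := enorm_ge0 s; have := enorm_ge0 v; have := enorm_ge0 (s + v).
have -> : 2 * dot s v + dot v v = enorm (s + v) ^+ 2 - enorm s ^+ 2.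
  by rewrite zE; ring.
move: z1 z2; set z := enorm (s + v); set r := enorm s; set q := enorm v.
move=> z1 z2 z0 q0 r0.
have zr : (z - r) ^+ 2 <= q ^+ 2 by nra.
have -> : z ^+ 3 = r ^+ 3 + 3 / 2 * r * (z ^+ 2 - r ^+ 2)
   + (z - r) ^+ 2 * (z + r / 2) by field.
rewrite lerD2l; apply: ler_pM => //; [exact: sqr_ge0|lra|lra].
Qed.

(** Along its own gradient [v] the model changes by at most t <v, v> + O(t^2), which
    would be negative for small t < 0. *)
Lemma cubic_stationary g H rho s : H^T = H -> 0 <= rho ->
  argmin (cubic_model g H rho) s ->
  g + s *m H + (rho / 2 * enorm s) *: s = 0.
Proof.
move=> sH rho0 opt; set v := g + s *m H + _.
apply: dot_eq0.
pose C := 1 / 2 * `|dot (v *m H) v| + rho / 6 *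
  (3 / 2 * enorm s * dot v v + enorm v ^+ 2 * (2 * enorm s + enorm v)).
have r0 := enorm_ge0 s; have q0 := enorm_ge0 v; have vv := dot_ge0 v.
apply: (@slope_ge0_eq0 _ C) => [//||t t1].
  rewrite /C; apply: addr_ge0; first by rewrite mulr_ge0 // divr_ge0.
  rewrite mulr_ge0 //; first lra.
  by rewrite addr_ge0 // !mulr_ge0 //; lra.
apply: le_trans (argmin_cubic_model _ _ _ _ (t *: v) sH opt) _.
have c := enorm_cube_le s (t *: v).
have E : dot v v = dot (g + s *m H) v + rho / 2 * enorm s * dot s v.
  by rewrite {1}/v dotDl dotZl.
have c' : enorm (s + t *: v) ^+ 3 - enorm s ^+ 3 <= 3 / 2 * enorm s *
   (2 * t * dot s v + t ^+ 2 * dot v v)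
   + t ^+ 2 * (enorm v ^+ 2 * (2 * enorm s + enorm v)).
  rewrite lerBlDl; apply: (le_trans c).
  rewrite addrA !dotZl !dotZr enormZ exprMn real_normK ?num_real //.
  have -> : 2 * (t * dot s v) + t * (t * dot v v)
    = 2 * t * dot s v + t ^+ 2 * dot v v by ring.
  rewrite lerD2l -mulrA ler_wpM2l ?sqr_ge0 // ler_wpM2l ?sqr_ge0 //.
  by rewrite lerD2l ler_piMl.
have h1 : dot (v *m H) v <= `|dot (v *m H) v| by exact: ler_norm.
have c2 : rho / 6 * (enorm (s + t *: v) ^+ 3 - enorm s ^+ 3) <= rho / 6 *
   (3 / 2 * enorm s * (2 * t * dot s v + t ^+ 2 * dot v v)
   + t ^+ 2 * (enorm v ^+ 2 * (2 * enorm s + enorm v))).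
  by rewrite ler_wpM2l //; lra.
rewrite {1}E -scalemxAl !dotZl !dotZr /C.
have t2 : t ^+ 2 * dot (v *m H) v <= t ^+ 2 * `|dot (v *m H) v|.
  by rewrite ler_wpM2l // sqr_ge0.
by nra.
Qed.

(** Global minimality is stronger than local minimality here.  Reflecting [s]
    in the hyperplane orthogonal to [u] preserves the norm, so that the cubic
    terms cancel and the difference of the model values is a positive multiple
    of the quadratic form at [u].  This covers every [u] not orthogonal to [s];
    the others are limits of such vectors, and if [s] is 0 the cubic term is
    negligible near [s]. *)
Lemma cubic_curvature g H rho s w : H^T = H -> 0 <= rho ->
  argmin (cubic_model g H rho) s ->
  0 <= dot (w *m H) w + rho / 2 * enorm s * dot w w.
Proof.
move=> sH rho0 opt.
have st := cubic_stationary _ _ _ _ sH rho0 opt.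
have gE u : dot (g + s *m H) u = - (rho / 2 * enorm s * dot s u).
  have : dot (g + s *m H + (rho / 2 * enorm s) *: s) u = 0 by rewrite st dot0l.
  by rewrite [X in X = _]dotDl dotZl => /eqP; rewrite addr_eq0 => /eqP.
have Qpos u : dot s u != 0 ->
    0 <= dot (u *m H) u + rho / 2 * enorm s * dot u u.
  move=> su.
  have uu : dot u u != 0 by apply: contraNneq su => /dot_eq0 ->; rewrite dot0r.
  (* [s + t *: u] is the reflection of [s] *)
  pose t := - (2 * dot s u / dot u u).
  have t0 : t != 0 by rewrite oppr_eq0 !mulf_neq0 ?invr_eq0 // pnatr_eq0.
  have := argmin_cubic_model _ _ _ _ (t *: u) sH opt.
  have e : enorm (s + t *: u) = enorm s.
    rewrite /enorm; congr Num.sqrt; rewrite !dot_linE (dotC u s) /t.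
    by field.
  rewrite e subrr mulr0 addr0 -scalemxAl !dotZl !dotZr gE => h.
  have t2 : 0 < t ^+ 2 by rewrite lt_neqAle eq_sym expf_neq0 //= sqr_ge0.
  rewrite -(pmulr_rge0 _ t2).
  have tu : t * dot u u = - 2 * dot s u.
    by rewrite /t; field.
  have : t * - (rho / 2 * enorm s * dot s u)
      = rho / 2 * enorm s * t * (t * dot u u) / 2 by rewrite tu; field.
  move=> E; move: h; rewrite E; lra.
have [s0|s0] := eqVneq s 0.
  apply: (@limit_at0_ge0 _ (rho / 3 * enorm w ^+ 3) 0) => t t0.
  have := argmin_cubic_model _ _ _ _ (t *: w) sH opt.
  rewrite -scalemxAl !dotZl !dotZr gE.
  rewrite s0 add0r enorm0 dot0l enormZ gtr0_norm // expr0n /= => h.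
  have t2 : 0 < t ^+ 2 by apply: exprn_gt0.
  rewrite -(pmulr_rge0 _ t2).
  by move: h; lra.
have [sw|] := eqVneq (dot s w) 0; last exact: Qpos.
have ss : dot s s != 0 by apply: contraNneq s0 => /dot_eq0 ->.
apply: (@limit_at0_ge0 _ (2 * (dot (w *m H) s + rho / 2 * enorm s * dot w s))
  (dot (s *m H) s + rho / 2 * enorm s * dot s s)) => t t0.
have := Qpos (w + t *: s).
rewrite !dot_linE sw add0r mulf_neq0 ?(gt_eqF t0) // => /(_ isT).
have e : dot (s *m H) w = dot (w *m H) s by rewrite dot_sym // dotC.
rewrite mulmxDl -scalemxAl !dot_linE e (dotC w s) sw.
by move=> h; apply: (le_trans h); lra.
Qed.
End CubicModel.

(** * Functions with a Lipschitz Hessian *)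

Section Calculus.
Context {R : realType} {d : nat}.
Implicit Types (f : 'rV[R]_d -> R) (x s u v w : 'rV[R]_d).

(** Along the line through [x] with direction [s] the difference quotients are
    those of [F] in direction [s]. *)
Lemma is_derive_along {W : normedModType R} (F : 'rV[R]_d -> W) x s (t : R) dF :
  is_derive (x + t *: s) s F dF -> is_derive t 1 (fun r => F (x + r *: s)) dF.
Proof.
have e : (fun h => h^-1 *: (F (x + (h *: 1 + t) *: s) - F (x + t *: s)))
      = (fun h => h^-1 *: (F (h *: s + (x + t *: s)) - F (x + t *: s))).
  apply/funext => h; rewrite (_ : x + (h *: 1 + t) *: s = h *: s + (x + t *: s)) //.
  by rewrite scalerDl [h *: 1]mulr1 addrCA.
by case=> dv <-; split; rewrite /derivable /derive /= e.
Qed.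

Lemma derive_gradient f x s : differentiable f x ->
  is_derive x s f (dot (gradient f x) s).
Proof.
move=> df; split; first exact: diff_derivable.
rewrite deriveE // [in LHS](row_sum_delta s) linear_sum.
by apply: eq_bigr => j _; rewrite linearZ /= mxE deriveE // mulrC.
Qed.

Lemma derive_gradient_hessian f x s v : differentiable (gradient f) x ->
  is_derive x s (fun y => dot (gradient f y) v) (dot (s *m hessian f x) v).
Proof.
move=> dg; have dgs : derivable (gradient f) x s by exact: diff_derivable.
have -> : (fun y => dot (gradient f y) v)
    = \sum_(j < d) (fun y => gradient f y 0 j * v 0 j).
  by apply/funext => y; rewrite fct_sumE.
apply: is_derive_sum => j.
have dj : derivable (fun y => gradient f y 0 j) x s.
  by have /derivable_mxP := dgs; apply.
have -> : (s *m hessian f x) 0 j = 'D_s (fun y => gradient f y 0 j) x.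
  by rewrite -deriveEjacobian // derive_mx // mxE.
split; last by rewrite mulrC -(deriveMr _ dj).
apply: (derivableM dj); exact: derivable_cst.
Qed.

Lemma le_of_derive_le0 (h dh : R -> R) (b : R) : 0 <= b ->
  (forall t : R, is_derive t 1 h (dh t)) -> (forall t, 0 <= t -> t <= b -> dh t <= 0) ->
  h b <= h 0.
Proof.
move=> b0 Dh dh0.
have [|c c0b] := MVT_segment b0 (fun t _ => Dh t).
  by apply: derivable_within_continuous => t _; have [] := Dh t.
move: c0b; rewrite in_itv => /andP[c0 cb].
by rewrite subr0 -subr_le0 => ->; rewrite mulr_le0_ge0 // dh0.
Qed.

Lemma is_derive_monomial (k : R) n (t : R) :
  is_derive t 1 (fun r : R => k * r ^+ n) (k * (n%:R * t ^+ n.-1)).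
Proof.
have -> : (fun r : R => k * r ^+ n) = k *: ((id : R -> R) ^+ n).
  by apply/funext => r; rewrite !fctE.
have D := is_deriveZ k (is_deriveX n (is_derive_id t (1 : R))).
by apply: (is_derive_eq D); rewrite /GRing.scale /= mulr1.
Qed.

Lemma is_derive_funD (F G : R -> R) (t dF dG : R) :
  is_derive t 1 F dF -> is_derive t 1 G dG ->
  is_derive t 1 (fun r => F r + G r) (dF + dG).
Proof. by move=> DF DG; exact: (is_deriveD DF DG). Qed.

Lemma is_derive_funB (F G : R -> R) (t dF dG : R) :
  is_derive t 1 F dF -> is_derive t 1 G dG ->
  is_derive t 1 (fun r => F r - G r) (dF - dG).
Proof. by move=> DF DG; exact: (is_deriveB DF DG). Qed.

Lemma is_derive_fun_idM (G : R -> R) (t dG : R) :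
  is_derive t 1 G dG -> is_derive t 1 (fun r => r * G r) (t * dG + G t).
Proof.
move=> DG; apply: is_derive_eq (is_deriveM (is_derive_id t (1 : R)) DG) _.
by rewrite /GRing.scale /= mulr1.
Qed.

Section Smooth.
Variables (f : 'rV[R]_d -> R) (L : R).
Hypothesis f_diff : forall x, differentiable f x.
Hypothesis grad_diff : forall x, differentiable (gradient f) x.
Hypothesis L_ge0 : 0 <= L.
Hypothesis hess_lip :
  forall y z, specnorm (hessian f y - hessian f z) <= L * enorm (y - z).

Let is_derive_f x s (t : R) : is_derive t 1 (fun r => f (x + r *: s))
  (dot (gradient f (x + t *: s)) s).
Proof. by apply: is_derive_along; exact: derive_gradient. Qed.

Let is_derive_g x s v (t : R) :
  is_derive t 1 (fun r => dot (gradient f (x + r *: s)) v)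
    (dot (s *m hessian f (x + t *: s)) v).
Proof.
apply: (@is_derive_along _ (fun y => dot (gradient f y) v)).
exact: derive_gradient_hessian.
Qed.

Lemma hessian_lipschitz y z s v :
  dot (s *m hessian f y) v - dot (s *m hessian f z) v
    <= L * enorm (y - z) * enorm s * enorm v.
Proof.
rewrite -dotNl -dotDl -mulmxBr; apply: le_trans (dot_le _ _) _.
rewrite ler_wpM2r ?enorm_ge0 //; apply: le_trans (specnorm_le _ _) _.
by rewrite ler_wpM2r ?enorm_ge0.
Qed.

Lemma gradient_taylor x s :
  enorm (gradient f (x + s) - gradient f x - s *m hessian f x)
    <= L / 2 * enorm s ^+ 2.
Proof.
apply: enorm_le_dual => [|v]; first by rewrite mulr_ge0 ?sqr_ge0 // divr_ge0.
pose c := dot (s *m hessian f x) v.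
pose k := L / 2 * enorm s ^+ 2 * enorm v.
pose h (t : R) := dot (gradient f (x + t *: s)) v - (c * t ^+ 1 + k * t ^+ 2).
suff : h 1 <= h 0.
  rewrite /h scale1r scale0r addr0 !dotDl !dotNl -/c -/k.
  by rewrite expr0n expr1n /=; lra.
apply: (le_of_derive_le0 h
  (fun t => dot (s *m hessian f (x + t *: s)) v - (c + k * (2 * t)))) => // t.
  have := is_derive_funB _ _ _ _ _ (is_derive_g x s v t) (is_derive_funD _ _ _ _ _
    (is_derive_monomial c 1 t) (is_derive_monomial k 2 t)).
  by rewrite /= mulr1 expr1 mulr1.
move=> t0 _; rewrite subr_le0 -lerBlDl.
apply: le_trans (hessian_lipschitz _ _ _ _) _.
have -> : x + t *: s - x = t *: s by rewrite addrC addKr.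
rewrite enormZ (ger0_norm t0) /k.
by move: (enorm s) (enorm v) => A B; lra.
Qed.

(** Around the midpoint [m] of the segment, the error [h t] of the trapezoid rule
    on [m - t s, m + t s] has a derivative in which values and gradients cancel;
    only t times a difference of second derivatives at distance 2 t |s| is left.
    This symmetry is what gives the constant 1/12. *)
Lemma trapezoid x s :
  f (x + s) - f x - dot (gradient f x + gradient f (x + s)) s / 2
    <= L / 12 * enorm s ^+ 3.
Proof.
pose m := x + (1 / 2) *: s.
pose k := 2 / 3 * L * enorm s ^+ 3.
pose g (y : 'rV[R]_d) := dot (gradient f y) s.
pose h (t : R) := f (m + t *: s) - f (m + t *: - s)
  - t * (g (m + t *: s) + g (m + t *: - s)) - k * t ^+ 3.
have e1 : m + (1 / 2) *: s = x + s.
  by rewrite /m -addrA -scalerDl -splitr scale1r.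
have e0 : m + (1 / 2) *: - s = x by rewrite scalerN addrK.
suff : h (1 / 2) <= h 0.
  rewrite /h e0 e1 !scale0r addr0 expr0n /= mul0r mulr0 !subr0 subrr.
  by rewrite /g /k dotDl; lra.
pose dh t := - (t * (dot (s *m hessian f (m + t *: s)) s
   - dot (s *m hessian f (m + t *: - s)) s)) - k * (3 * t ^+ 2).
apply: (le_of_derive_le0 h dh) => [||t t0 _]; first by rewrite divr_ge0.
  move=> t.
  have Df := is_derive_funB _ _ _ _ _ (is_derive_f m s t) (is_derive_f m (- s) t).
  have Dg := is_derive_funD _ _ _ _ _ (is_derive_g m s s t) (is_derive_g m (- s) s t).
  have D := is_derive_funB _ _ _ _ _ (is_derive_funB _ _ _ _ _ Df
    (is_derive_fun_idM _ _ _ Dg)) (is_derive_monomial k 3 t).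
  apply: is_derive_eq D _.
  rewrite /dh (dotNr (gradient f (m + t *: - s)) s).
  rewrite (mulNmx s (hessian f (m + t *: - s))).
  rewrite (dotNl (s *m hessian f (m + t *: - s)) s).
  have aux (p q P Q X : R) :
    p - (- q) - (t * (P + - Q) + (p + q)) - X = - (t * (P - Q)) - X by ring.
  exact: aux.
have e2 : m + t *: s - (m + t *: - s) = (2 * t) *: s.
  by rewrite opprD addrACA subrr add0r scalerN opprK -scalerDl -mulr2n mulr_natl.
rewrite /dh -mulrN opprB subr_le0.
apply: le_trans (ler_wpM2l t0 (hessian_lipschitz _ _ _ _)) _.
rewrite enormB e2 enormZ ger0_norm ?mulr_ge0 // /k.
by move: (enorm s) => A; lra.
Qed.

Lemma gradient_difference x s s' u :
  dot (gradient f (x + s)) u - dot (gradient f (x + s')) u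
    <= dot ((s - s') *m hessian f x) u
       + L / 2 * (enorm s ^+ 2 + enorm s' ^+ 2) * enorm u.
Proof.
pose E (z : 'rV[R]_d) := gradient f (x + z) - gradient f x - z *m hessian f x.
have gE z : gradient f (x + z) = E z + gradient f x + z *m hessian f x.
  by rewrite /E addrAC !subrK.
have Eb z : enorm (E z) <= L / 2 * enorm z ^+ 2 := gradient_taylor x z.
clearbody E; rewrite (gE s) (gE s') mulmxBl !dotDl dotNl.
have := dot_le (E s) u; have := dot_ge (E s') u.
have := ler_wpM2r (enorm_ge0 u) (Eb s); have := ler_wpM2r (enorm_ge0 u) (Eb s').
move: (dot (E s) u) (dot (E s') u) (enorm (E s)) (enorm (E s')).
move: (enorm u) (enorm s) (enorm s') => U S S' a b c e.
by lra.
Qed.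

(** With one of [w], [w'] equal to 0, the left-hand side is a second difference of
    [f] at [x], up to sign. *)
Lemma increment_difference x w w' u t b : 0 <= t ->
  enorm w + t * enorm u <= b -> enorm w' + t * enorm u <= b ->
  f (x + w + t *: u) - f (x + w) - (f (x + w' + t *: u) - f (x + w'))
    <= t * (dot ((w - w') *m hessian f x) u + L * b ^+ 2 * enorm u).
Proof.
move=> t0 wb w'b.
pose c := dot ((w - w') *m hessian f x) u + L * b ^+ 2 * enorm u.
pose h (r : R) := f (x + w + r *: u) - f (x + w' + r *: u) - c * r ^+ 1.
suff : h t <= h 0.
  rewrite /h !scale0r !addr0 mulr0 subr0 expr1 -/c.
  move: (f (x + w + t *: u)) (f (x + w)) (f (x + w' + t *: u)) (f (x + w')).
  by move=> A B C D; lra.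
apply: (le_of_derive_le0 h (fun r => dot (gradient f (x + w + r *: u)) u
    - dot (gradient f (x + w' + r *: u)) u - c)) => [//||r r0 rt].
  move=> r; have := is_derive_funB _ _ _ _ _ (is_derive_funB _ _ _ _ _
    (is_derive_f (x + w) u r) (is_derive_f (x + w') u r)) (is_derive_monomial c 1 r).
  by rewrite /= expr0 !mulr1.
rewrite subr_le0 -!addrA; apply: le_trans (gradient_difference _ _ _ _) _.
have bound z : enorm z + t * enorm u <= b -> enorm (z + r *: u) ^+ 2 <= b ^+ 2.
  move=> zb; have zb' : enorm (z + r *: u) <= b.
    apply: le_trans (enormD _ _) (le_trans _ zb).
    by rewrite enormZ (ger0_norm r0) lerD2l ler_wpM2r ?enorm_ge0.
  by rewrite lerXn2r ?nnegrE ?enorm_ge0 // (le_trans _ zb') ?enorm_ge0.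
rewrite opprD addrACA subrr addr0 /c lerD2l ler_wpM2r ?enorm_ge0 //.
have := ler_wpM2l L_ge0 (lerD (bound w wb) (bound w' w'b)).
by move: (enorm (w + r *: u)) (enorm (w' + r *: u)) => A B; lra.
Qed.

(** Schwarz's theorem.  The second difference of [f] at [x] along [t u] and [t v]
    is an increment along [u] as well as along [v]; up to a cubic error in [t] it
    is therefore t^2 times the second derivative, in either order. *)
Lemma hessian_sym x : (hessian f x)^T = hessian f x.
Proof.
have le_uv u v : dot (v *m hessian f x) u <= dot (u *m hessian f x) v.
  rewrite -subr_ge0.
  pose B := enorm u + enorm v.
  apply: (@limit_at0_ge0 _ _ (L * B ^+ 2 * (enorm u + enorm v)) 0) => t t0.
  have tw := ltW t0.
  have := @increment_difference x 0 (t *: v) u t (t * B) tw.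
  have := @increment_difference x (t *: u) 0 v t (t * B) tw.
  rewrite enorm0 !enormZ (gtr0_norm t0) !addr0 subr0 sub0r mulNmx dotNl.
  rewrite -!scalemxAl !dotZl -!mulrDr (addrC (enorm v)) !add0r.
  rewrite (addrAC x (t *: v)) /B.
  have bu : t * enorm u <= t * (enorm u + enorm v).
    by rewrite ler_wpM2l // lerDl enorm_ge0.
  have bv : t * enorm v <= t * (enorm u + enorm v).
    by rewrite ler_wpM2l // lerDr enorm_ge0.
  move=> /(_ (lexx _) bv) h1 /(_ bu (lexx _)) h2.
  have t2 : 0 < t ^+ 2 by apply: exprn_gt0.
  rewrite -(pmulr_rge0 _ t2).
  move: h1 h2; move: (f _) (f _) (f _) (f _) => F1 F2 F3 F4.
  move: (dot (u *m _) v) (dot (v *m _) u) (enorm u) (enorm v) => X Y U V.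
  by lra.
apply/matrixP => i j; rewrite mxE.
have e k l : dot (delta_mx 0 k *m hessian f x) (delta_mx 0 l) = hessian f x k l.
  rewrite -rowE /dot (bigD1 l) //= big1 => [|m ml]; rewrite !mxE ?eqxx /=.
    by rewrite mulr1 addr0.
  by rewrite (negPf ml) mulr0.
by rewrite -[LHS]e -[RHS]e; apply: le_anti; rewrite !le_uv.
Qed.
End Smooth.
End Calculus.

(** * One step of the method *)

(** In terms of p = <G, s>, g = |G| and W = |G + 10 L n r s|: the expansion of
    W^2 eliminates p from the decrease, and 1/5 is the weight of g^2
    for which p cancels exactly. *)
Lemma gradient_power_le {R : realType} (L n r E g p q W : R) :
  0 < L -> 1 <= n -> 0 < r -> 0 <= E -> 0 <= g -> 0 <= W ->
  W ^+ 2 = g ^+ 2 + 20 * L * n * r * p + 100 * L ^+ 2 * n ^+ 2 * r ^+ 4 ->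
  W <= L * (E + r / 2) * r -> - p / 2 - L / 12 * r ^+ 3 <= q ->
  g * Num.sqrt g / Num.sqrt n <= Num.sqrt L * (8 * q
    + L * (2 / 10 * (E + r / 2) ^+ 2 * r / n + 2 / 3 * r ^+ 3
           - 6816 / 1000 * n * r ^+ 3)).
Proof.
move=> L0 n1 r0 E0 g0 W0 WE Wle qge.
have n0 : 0 < n by lra.
pose y := Num.sqrt g; pose a := Num.sqrt n; pose b := Num.sqrt L.
have y0 : 0 <= y by exact: sqrtr_ge0.
have a0 : 0 < a by rewrite sqrtr_gt0.
have b0 : 0 < b by rewrite sqrtr_gt0.
have gE : g = y ^+ 2 by rewrite sqr_sqrtr.
have nE : n = a ^+ 2 by rewrite sqr_sqrtr // ltW.
have LE : L = b ^+ 2 by rewrite sqr_sqrtr // ltW.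
rewrite -/y -/a -/b.
have amgm : y ^+ 3 * (a * b * r) <= 2 / 10 * y ^+ 4 + 13184 / 1000 * (a * b * r) ^+ 4.
  set h := a * b * r.
  have h0 : 0 <= h by rewrite !mulr_ge0 // ltW.
  (* double root at y = 15/4 h; the constant term 3375/256 is rounded up *)
  have : 0 <= (y - 15 / 4 * h) ^+ 2 * (2 / 10 * y ^+ 2 + 1 / 2 * y * h + 15 / 16 * h ^+ 2).
    rewrite mulr_ge0 ?sqr_ge0 // !addr_ge0 ?mulr_ge0 ?exprn_ge0 //; lra.
  by have := exprn_ge0 4 h0; nra.
have W2 : W ^+ 2 <= (L * (E + r / 2) * r) ^+ 2.
  by rewrite lerXn2r ?nnegrE // (le_trans W0).
rewrite -(ler_pM2r (mulr_gt0 (mulr_gt0 n0 L0) r0)).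
have -> : g * y / a * (n * L * r) = b * (y ^+ 3 * (a * b * r)).
  by rewrite gE nE LE; field; rewrite gt_eqF.
rewrite -[leRHS]mulrA ler_pM2l //; apply: (le_trans amgm).
have -> : (8 * q + L * (2 / 10 * (E + r / 2) ^+ 2 * r / n + 2 / 3 * r ^+ 3
           - 6816 / 1000 * n * r ^+ 3)) * (n * L * r)
   = 8 * q * (n * L * r) + 2 / 10 * (L * (E + r / 2) * r) ^+ 2
     + L ^+ 2 * n * (2 / 3 * r ^+ 4) - 6816 / 1000 * L ^+ 2 * n ^+ 2 * r ^+ 4.
  by field; rewrite gt_eqF.
have -> : y ^+ 4 = g ^+ 2 by rewrite gE; ring.
have -> : (a * b * r) ^+ 4 = L ^+ 2 * n ^+ 2 * r ^+ 4 by rewrite nE LE; ring.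
have nLr : 0 <= n * L * r by rewrite !mulr_ge0 // ltW.
have := ler_wpM2r nLr qge.
move: WE W2; set V := (L * (E + r / 2) * r) ^+ 2 => -> W2.
by lra.
Qed.

(** One step from [x] with the inexact Hessian [H], where [L * E] bounds the error
    of [H] at [x] and [n] stands for 1 + tau. *)
Section OneStep.
Context {R : realType} {d : nat}.
Variables (f : 'rV[R]_d -> R) (L : R).
Hypothesis f_diff : forall x, differentiable f x.
Hypothesis grad_diff : forall x, differentiable (gradient f) x.
Hypothesis L_gt0 : 0 < L.
Hypothesis hess_lip :
  forall y z, specnorm (hessian f y - hessian f z) <= L * enorm (y - z).
Variables (H : 'M[R]_d) (x s : 'rV[R]_d) (n E : R).
Hypothesis H_sym : H^T = H.
Hypothesis n_ge1 : 1 <= n.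
Hypothesis E_ge0 : 0 <= E.
Hypothesis H_err : forall v, enorm (v *m (H - hessian f x)) <= L * E * enorm v.
Hypothesis opt : argmin (cubic_model (gradient f x) H (20 * L * n)) s.
Let r := enorm s.
Let G := gradient f (x + s).

Let L_ge0 : 0 <= L. Proof. exact: ltW. Qed.
Let rho_ge0 : 0 <= 20 * L * n.
Proof.
rewrite mulr_ge0 //; last exact: le_trans ler01 n_ge1.
by rewrite mulr_ge0 // ltW.
Qed.
Let r_ge0 : 0 <= r. Proof. exact: enorm_ge0. Qed.

Lemma new_gradient_error :
  enorm (G + (10 * L * n * r) *: s) <= L * (E + r / 2) * r.
Proof.
have st := cubic_stationary _ _ _ _ H_sym rho_ge0 opt.
have -> : G + (10 * L * n * r) *: s =
   (G - gradient f x - s *m hessian f x) - s *m (H - hessian f x).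
  rewrite mulmxBr opprB addrA subrK.
  have -> : gradient f x = - (s *m H) - (20 * L * n / 2 * enorm s) *: s.
    by apply/eqP; rewrite -opprD -addr_eq0 addrA st.
  rewrite opprB opprK addrA addrK; congr (_ + _ *: _).
  by rewrite /r; field.
apply: le_trans (enormD _ _) _; rewrite enormN.
have := gradient_taylor f L grad_diff L_ge0 hess_lip x s.
have := H_err s; rewrite -/r -/G; lra.
Qed.

(** The gradient at [x] contributes with the good sign, because, by
    stationarity, the curvature condition along [s] reads <grad f(x), s> <= 0. *)
Lemma decrease_ge_gradient : - dot G s / 2 - L / 12 * r ^+ 3 <= f x - f (x + s).
Proof.
have st := cubic_stationary _ _ _ _ H_sym rho_ge0 opt.
have gs : dot (gradient f x) s <= 0.
  have := cubic_curvature _ _ _ _ s H_sym rho_ge0 opt.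
  have := congr1 (fun v => dot v s) st; rewrite !dotDl dotZl dot0l; lra.
have := trapezoid f L f_diff grad_diff hess_lip x s.
by rewrite dotDl -/r -/G; lra.
Qed.

Lemma new_gradient_power : enorm G * Num.sqrt (enorm G) / Num.sqrt n <=
  Num.sqrt L * (8 * (f x - f (x + s))
    + L * (2 / 10 * (E + r / 2) ^+ 2 * r / n + 2 / 3 * r ^+ 3
           - 6816 / 1000 * n * r ^+ 3)).
Proof.
have W := new_gradient_error; have D := decrease_ge_gradient.
have [r0|r0] := eqVneq r 0.
  have s0 : s = 0 by exact: enorm_eq0.
  have G0 : G = 0.
    apply/enorm_eq0/le_anti; rewrite enorm_ge0 andbT.
    by move: W; rewrite r0 !mulr0 s0 scaler0 addr0.
  move: D; rewrite G0 s0 dot0l addr0 subrr enorm0 r0 !expr0n /=.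
  by rewrite mul0r mul0r !mulr0 mul0r !(addr0, subr0, mulr0).
apply: (@gradient_power_le _ L n r E (enorm G) (dot G s) _
  (enorm (G + (10 * L * n * r) *: s))); rewrite ?enorm_ge0 //.
  by rewrite lt_neqAle eq_sym r0.
rewrite !enorm_sqr !dotDl !dotDr !dotZl !dotZr (dotC s G) -[dot s s]enorm_sqr -/r.
by ring.
Qed.

(** The same decrease with <G, s> estimated by Cauchy-Schwarz, which suffices for
    the curvature bound. *)
Lemma decrease_ge_cubic :
  L * (40 * n * r ^+ 3 - 4 * E * r ^+ 2 - 8 / 3 * r ^+ 3) <= 8 * (f x - f (x + s)).
Proof.
have W := new_gradient_error; have D := decrease_ge_gradient.
have := dot_le (G + (10 * L * n * r) *: s) s.
rewrite dotDl dotZl -enorm_sqr -/r => Gs.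
have := ler_wpM2r r_ge0 W; lra.
Qed.

Lemma new_curvature v : - (L * (10 * n * r + E + r)) * dot v v
  <= dot (v *m hessian f (x + s)) v.
Proof.
have key (A B C V : R) : 0 <= A + 20 * L * n / 2 * r * V ->
    B - C <= L * r * V -> A - B <= L * E * V ->
    - (L * (10 * n * r + E + r)) * V <= C by lra.
have c := cubic_curvature _ _ _ _ v H_sym rho_ge0 opt.
have l := hessian_lipschitz f L hess_lip x (x + s) v v.
have e : dot (v *m H) v - dot (v *m hessian f x) v <= L * E * dot v v.
  rewrite -dotNl -dotDl -mulmxBr; apply: le_trans (dot_le _ _) _.
  by rewrite -enorm_sqr expr2 mulrA ler_wpM2r ?enorm_ge0.
have xs : enorm (x - (x + s)) = r by rewrite opprD addrA subrr add0r enormN.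
rewrite xs -[X in _ <= X]mulrA -expr2 enorm_sqr in l.
exact: key c l e.
Qed.
End OneStep.

(** * The potential of a window *)

(** The potential of a window opened [p] iterations ago in which the iterates have
    travelled a distance [S]; at [p = 0] the division by zero gives 0. *)
Definition potential {R : realFieldType} (p : nat) (S : R) : R :=
  3 / 10 * S ^+ 3 / p%:R.

Section WindowSteps.
Context {R : realFieldType}.
Implicit Types p v r S c : R.

(** Each cubic inequality below holds because the difference of its sides is at
    least a positive multiple of such a product, where [a] is close to the
    minimizer of the difference at [r = 1]. *)
Lemma tangent_cubic_ge0 (a b : R) v r :
  0 <= v + b * r -> 0 <= (v - a * r) ^+ 2 * (v + b * r).
Proof. by move=> ?; rewrite mulr_ge0 // sqr_ge0. Qed.

(** Here and in the next two lemmas [v] is the mean step [S / p].  The terms of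
    second degree in [p] form the cubic inequality [A], which is the Hardy
    inequality for large [p].  As [A] is nonpositive up to its budget, [p ^+ 2]
    can be lowered to [p] in it, and the remaining terms only need the cubic
    inequality [B]. *)
Lemma first_order_window_poly p v r : 1 <= p -> 0 <= v -> 0 <= r ->
  4 / 10 * (p * v + r / 2) ^+ 2 * r + 3 / 10 * (p * v + r) ^+ 3
  <= 4 * (p + 1) ^+ 2 * r ^+ 3 + 3 / 10 * p ^+ 2 * (p + 1) * v ^+ 3.
Proof.
move=> p1 v0 r0.
have A : 13 / 10 * v ^+ 2 * r - 3 / 10 * v ^+ 3 <= 4 * r ^+ 3.
  have := @tangent_cubic_ge0 (26 / 9) (13 / 9) v r ltac:(nra).
  have : 0 <= r ^+ 3 by apply: exprn_ge0.
  by nra.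
have B : 13 / 10 * v ^+ 2 * r - 3 / 10 * v ^+ 3 + 13 / 10 * v * r ^+ 2
    <= 9 * r ^+ 3.
  have := @tangent_cubic_ge0 (10 / 3) (7 / 3) v r ltac:(nra).
  have : 0 <= r ^+ 3 by apply: exprn_ge0.
  have : 0 <= v * r ^+ 2 by rewrite mulr_ge0 // exprn_ge0.
  by nra.
have r3 : 0 <= r ^+ 3 by apply: exprn_ge0.
have pA : p ^+ 2 * (13 / 10 * v ^+ 2 * r - 3 / 10 * v ^+ 3 - 4 * r ^+ 3)
      <= p * (13 / 10 * v ^+ 2 * r - 3 / 10 * v ^+ 3 - 4 * r ^+ 3).
  rewrite ler_wnM2r ?subr_le0 //; nra.
have pB : p * (13 / 10 * v ^+ 2 * r - 3 / 10 * v ^+ 3 + 13 / 10 * v * r ^+ 2)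
    <= p * (9 * r ^+ 3).
  by rewrite ler_wpM2l //; lra.
have pr : 0 <= p * r ^+ 3 by rewrite mulr_ge0 //; lra.
nra.
Qed.

Lemma next_window_poly p v r : 1 <= p -> 0 <= v -> 0 <= r ->
  3 / 10 * (p * v + r) ^+ 3
  <= 12 / 10 * (p + 1) ^+ 2 * r ^+ 3 + 3 / 10 * p ^+ 2 * (p + 1) * v ^+ 3.
Proof.
move=> p1 v0 r0.
have A : 9 / 10 * v ^+ 2 * r - 3 / 10 * v ^+ 3 <= 12 / 10 * r ^+ 3.
  have := @tangent_cubic_ge0 2 1 v r ltac:(nra).
  by nra.
have B : 9 / 10 * v ^+ 2 * r - 3 / 10 * v ^+ 3 + 9 / 10 * v * r ^+ 2
    <= 36 / 10 * r ^+ 3.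
  have := @tangent_cubic_ge0 (5 / 2) 2 v r ltac:(nra).
  have : 0 <= r ^+ 3 by apply: exprn_ge0.
  have : 0 <= v * r ^+ 2 by rewrite mulr_ge0 // exprn_ge0.
  by nra.
have r3 : 0 <= r ^+ 3 by apply: exprn_ge0.
have pA : p ^+ 2 * (9 / 10 * v ^+ 2 * r - 3 / 10 * v ^+ 3 - 12 / 10 * r ^+ 3)
      <= p * (9 / 10 * v ^+ 2 * r - 3 / 10 * v ^+ 3 - 12 / 10 * r ^+ 3).
  rewrite ler_wnM2r ?subr_le0 //; nra.
have pB : p * (9 / 10 * v ^+ 2 * r - 3 / 10 * v ^+ 3 + 9 / 10 * v * r ^+ 2)
    <= p * (36 / 10 * r ^+ 3).
  by rewrite ler_wpM2l //; lra.
have pr : 0 <= p * r ^+ 3 by rewrite mulr_ge0 //; lra.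
nra.
Qed.

Lemma second_order_window_poly p v r : 1 <= p -> 0 <= v -> 0 <= r ->
  4 * (p + 1) * (p * v) * r ^+ 2 + 21 / 400 * p ^+ 2 * v ^+ 3
    + 3 / 10 * (p * v + r) ^+ 3
  <= 15 * (p + 1) ^+ 2 * r ^+ 3 + 3 / 10 * p ^+ 2 * (p + 1) * v ^+ 3.
Proof.
move=> p1 v0 r0.
have r3 : 0 <= r ^+ 3 by apply: exprn_ge0.
have vr2 : 0 <= v * r ^+ 2 by rewrite mulr_ge0 // exprn_ge0.
have v2r : 0 <= v ^+ 2 * r by rewrite mulr_ge0 // exprn_ge0.
have A : 9 / 10 * v ^+ 2 * r - 99 / 400 * v ^+ 3 + 4 * v * r ^+ 2
    <= 15 * r ^+ 3.
  have := @tangent_cubic_ge0 (23 / 6) (403 / 100) v r ltac:(nra).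
  by nra.
have B : 9 / 10 * v ^+ 2 * r - 99 / 400 * v ^+ 3 + 89 / 10 * v * r ^+ 2
    <= 40 * r ^+ 3.
  have := @tangent_cubic_ge0 (49 / 10) (616 / 100) v r ltac:(nra).
  by nra.
set X := 9 / 10 * v ^+ 2 * r - 99 / 400 * v ^+ 3 + 4 * v * r ^+ 2 in A.
have pA : p ^+ 2 * (X - 15 * r ^+ 3) <= p * (X - 15 * r ^+ 3).
  rewrite ler_wnM2r ?subr_le0 //; nra.
have pB : p * (X + 49 / 10 * v * r ^+ 2) <= p * (40 * r ^+ 3).
  by rewrite ler_wpM2l // ?/X; lra.
have pr : 0 <= p * r ^+ 3 by rewrite mulr_ge0 //; lra.
rewrite /X in pA pB; nra.
Qed.

Let moveDB (a b c d : R) : a + b - c - d = a - d + b - c.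
Proof. by ring. Qed.

(** Multiplying by the new rank [p.+1] and substituting S = p v turns the growth of
    the potential into a polynomial; a window with [p = 0] has no past. *)
Lemma potential_step (p : nat) S r c : 0 <= S -> 0 <= r -> (p = 0%N -> S = 0) ->
  (forall v, 0 <= v -> (1 <= p%:R :> R) -> S = p%:R * v ->
   c + 3 / 10 * (p%:R * v + r) ^+ 3
      <= 3 / 10 * p%:R ^+ 2 * (p%:R + 1) * v ^+ 3) ->
  (p = 0%N -> c + 3 / 10 * r ^+ 3 <= 0) ->
  c / p.+1%:R + potential p.+1 (S + r) - potential p S <= 0.
Proof.
move=> S0 r0 pS Hp H0; rewrite /potential.
case: p pS Hp H0 => [|p] pS Hp H0.
  by have := H0 erefl; rewrite (pS erefl) invr0 mulr0 subr0 add0r !divr1.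
set q := p.+1 in pS Hp H0 *.
have q1 : 1 <= q%:R :> R by rewrite ler1n.
have q0 : q%:R != 0 :> R by rewrite pnatr_eq0.
clearbody q.
have q0' : q%:R + 1 != 0 :> R by rewrite lt0r_neq0 //; lra.
have e : S = q%:R * (S / q%:R) by field.
have := Hp (S / q%:R) (divr_ge0 S0 (ler0n _ _)) q1 e.
rewrite -e -[q.+1%:R]natr1 => H.
have -> : c / (q%:R + 1) + 3 / 10 * (S + r) ^+ 3 / (q%:R + 1)
   - 3 / 10 * S ^+ 3 / q%:R =
   (c + 3 / 10 * (S + r) ^+ 3
     - 3 / 10 * q%:R ^+ 2 * (q%:R + 1) * (S / q%:R) ^+ 3) / (q%:R + 1).
  by field; rewrite q0'.
apply: mulr_le0_ge0; first by rewrite subr_le0.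
by rewrite invr_ge0; lra.
Qed.

(** The active window: the coefficient of the squared Hessian error is twice what
    a step needs, because [first_order_step0] splits (S + d)^2 into
    2 S^2 + 2 d^2. *)
Lemma first_order_window (p : nat) S r : 0 <= S -> 0 <= r -> (p = 0%N -> S = 0) ->
  4 / 10 * (S + r / 2) ^+ 2 * r / p.+1%:R + potential p.+1 (S + r) - potential p S
    <= 4 * p.+1%:R * r ^+ 3.
Proof.
move=> S0 r0 pS; have n0 : p.+1%:R != 0 :> R by rewrite pnatr_eq0.
have r3 : 0 <= r ^+ 3 by apply: exprn_ge0.
have := @potential_step p S r
  (4 / 10 * (S + r / 2) ^+ 2 * r - 4 * p.+1%:R ^+ 2 * r ^+ 3) S0 r0 pS.
rewrite mulrBl.
have -> : 4 * p.+1%:R ^+ 2 * r ^+ 3 / p.+1%:R = 4 * p.+1%:R * r ^+ 3 :> R.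
  by move: (p.+1%:R) n0 => n n0; field.
set n := p.+1%:R => H.
rewrite -subr_le0 moveDB; apply: H.
- move=> v v0 p1 ->; rewrite /n -[p.+1%:R]natr1.
  by have := first_order_window_poly _ _ _ p1 v0 r0; lra.
- by move=> p0; rewrite /n (pS p0) p0; lra.
Qed.

(** The window that will be active next only has its growth to pay for. *)
Lemma next_window (p : nat) S r : 0 <= S -> 0 <= r -> (p = 0%N -> S = 0) ->
  potential p.+1 (S + r) - potential p S <= 12 / 10 * p.+1%:R * r ^+ 3.
Proof.
move=> S0 r0 pS; have n0 : p.+1%:R != 0 :> R by rewrite pnatr_eq0.
have r3 : 0 <= r ^+ 3 by apply: exprn_ge0.
have := @potential_step p S r (- (12 / 10 * p.+1%:R ^+ 2 * r ^+ 3)) S0 r0 pS.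
rewrite mulNr.
have -> : 12 / 10 * p.+1%:R ^+ 2 * r ^+ 3 / p.+1%:R = 12 / 10 * p.+1%:R * r ^+ 3 :> R.
  by move: (p.+1%:R) n0 => n n0; field.
set n := p.+1%:R => H.
rewrite -subr_le0 addrC addrA; apply: H.
- move=> v v0 p1 _; rewrite /n -[p.+1%:R]natr1.
  by have := next_window_poly _ _ _ p1 v0 r0; lra.
- by move=> p0; rewrite /n p0; lra.
Qed.

(** The active window in the curvature bound, where the Hessian error enters the
    decrease linearly and the curvature through its cube. *)
Lemma second_order_window (p : nat) S r : 0 <= S -> 0 <= r -> (p = 0%N -> S = 0) ->
  4 * S * r ^+ 2 + 21 / 400 * S ^+ 3 / p.+1%:R ^+ 2
    + potential p.+1 (S + r) - potential p S <= 15 * p.+1%:R * r ^+ 3.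
Proof.
move=> S0 r0 pS; have n0 : p.+1%:R != 0 :> R by rewrite pnatr_eq0.
have n1 : 0 < p.+1%:R :> R by rewrite ltr0n.
have r3 : 0 <= r ^+ 3 by apply: exprn_ge0.
have := @potential_step p S r (4 * p.+1%:R * S * r ^+ 2
  + 21 / 400 * S ^+ 3 / p.+1%:R - 15 * p.+1%:R ^+ 2 * r ^+ 3) S0 r0 pS.
have -> : (4 * p.+1%:R * S * r ^+ 2
  + 21 / 400 * S ^+ 3 / p.+1%:R - 15 * p.+1%:R ^+ 2 * r ^+ 3) / p.+1%:R
  = 4 * S * r ^+ 2 + 21 / 400 * S ^+ 3 / p.+1%:R ^+ 2 - 15 * p.+1%:R * r ^+ 3 :> R.
  by move: (p.+1%:R) n0 {n1} => n n0; field.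
set n := p.+1%:R => H.
rewrite -subr_le0 moveDB; apply: H.
- move=> v v0 p1 ->; rewrite /n -[p.+1%:R]natr1.
  have : (p%:R * v) ^+ 3 / (p%:R + 1) <= p%:R ^+ 2 * v ^+ 3.
    rewrite ler_pdivrMr; last by lra.
    have : 0 <= p%:R ^+ 2 * v ^+ 3 by rewrite mulr_ge0 // exprn_ge0 //; lra.
    by nra.
  by have := second_order_window_poly _ _ _ p1 v0 r0; lra.
- by move=> p0; rewrite /n (pS p0) p0; lra.
Qed.
End WindowSteps.

(** * The budget of one iteration *)

Section StepInequalities.
Context {R : realFieldType}.
Implicit Types r S d x y z N : R.

(** 4 for the active window and 1.2 for the next one fit into 6.816. *)
Lemma first_order_step (p l : nat) S S' r :
  0 <= S -> 0 <= S' -> 0 <= r -> (l < p)%N -> (l = 0%N -> S' = 0) ->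
  2 / 10 * (S + r / 2) ^+ 2 * r / p.+1%:R + 2 / 3 * r ^+ 3
    - 6816 / 1000 * p.+1%:R * r ^+ 3
  <= (potential p S - potential p.+1 (S + r))
     + (potential l S' - potential l.+1 (S' + r)).
Proof.
move=> S0 S0' r0 lp l0.
have p0 : p = 0%N -> S = 0 by move=> pz; rewrite pz in lp.
have r3 : 0 <= r ^+ 3 by apply: exprn_ge0.
have W := first_order_window p S r S0 r0 p0.
have W' := next_window l S' r S0' r0 l0.
have n2 : 2 <= p.+1%:R :> R by rewrite ler_nat ltnS (leq_ltn_trans _ lp).
have ln : l.+1%:R * r ^+ 3 <= p.+1%:R * r ^+ 3.
  by rewrite ler_wpM2r // ler_nat ltnS ltnW.
have nr : 2 * r ^+ 3 <= p.+1%:R * r ^+ 3 by rewrite ler_wpM2r.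
have q0 : 0 <= (S + r / 2) ^+ 2 * r / p.+1%:R.
  by rewrite divr_ge0 // mulr_ge0 // sqr_ge0.
move: q0 W W' ln nr; rewrite -!mulrA; set n := p.+1%:R; set m := l.+1%:R.
set Q := (S + r / 2) * _; set nr := n * _; set mr := m * _.
by lra.
Qed.

(** During job 0 only one window is open, but the initial error [d] has to be paid
    for.  At [p = 0] nothing has been travelled, and afterwards [n >= 2] halves
    the cost of [d]; both cases leave a cubic inequality between [d] and [r]. *)
Lemma first_order_step0 (p : nat) S r d :
  0 <= S -> 0 <= r -> 0 <= d -> (p = 0%N -> S = 0) ->
  2 / 10 * (S + d + r / 2) ^+ 2 * r / p.+1%:R + 2 / 3 * r ^+ 3
    - 6816 / 1000 * p.+1%:R * r ^+ 3
  <= 2 / 100 * d ^+ 3 + (potential p S - potential p.+1 (S + r)).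
Proof.
move=> S0 r0 d0 p0.
have r3 : 0 <= r ^+ 3 by apply: exprn_ge0.
have dr2 : 0 <= d * r ^+ 2 by rewrite mulr_ge0 // exprn_ge0.
case: p p0 => [|p] p0.
  rewrite (p0 erefl) /potential invr0 !divr1 mulr0 !add0r.
  have := @tangent_cubic_ge0 R (143 / 20) (43 / 10) d r ltac:(nra).
  by nra.
have W := first_order_window p.+1 S r S0 r0 p0.
have n2 : 2 <= p.+2%:R :> R by rewrite ler_nat.
have nr : 2 * r ^+ 3 <= p.+2%:R * r ^+ 3 by rewrite ler_wpM2r.
have D : 2 / 10 * (S + d + r / 2) ^+ 2 * r / p.+2%:R <=
   4 / 10 * (S + r / 2) ^+ 2 * r / p.+2%:R + 2 / 10 * (d ^+ 2 * r).
  have d2r : 0 <= d ^+ 2 * r by rewrite mulr_ge0 // exprn_ge0.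
  have d2n : (d ^+ 2 * r) * 2 <= (d ^+ 2 * r) * p.+2%:R by rewrite ler_wpM2l.
  rewrite ler_pdivrMr ?ltr0n // [X in _ <= X]mulrDl divfK ?pnatr_eq0 //.
  rewrite -[2 / 10 * (d ^+ 2 * r) * _]mulrA.
  have sq : 0 <= (S + r / 2 - d) ^+ 2 * r by rewrite mulr_ge0 // sqr_ge0.
  move: d2n; set X := d ^+ 2 * r * p.+2%:R => d2n.
  by nra.
have T : d ^+ 3 - 10 * (d ^+ 2 * r) + 149 * r ^+ 3 >= 0.
  have := @tangent_cubic_ge0 R (20 / 3) (10 / 3) d r ltac:(nra).
  by nra.
move: W nr D; rewrite -!mulrA; set n := p.+2%:R.
set Q := (S + r / 2) * _; set Q' := (S + d + r / 2) * _.
have -> : d * (d * r) = d ^+ 2 * r by rewrite mulrA.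
set nr := n * _; set d2r := d ^+ 2 * r in T *.
by lra.
Qed.

(** Hoelder's inequality with weights 2/3 and 1/3, and below with 1/2, 1/4 and
    1/4; they are chosen so that the leading term 10 n r stays affordable. *)
Lemma cube_sum2_le x y : 0 <= x -> 0 <= y ->
  (x + y) ^+ 3 <= 9 / 4 * x ^+ 3 + 9 * y ^+ 3.
Proof.
move=> x0 y0.
have := @tangent_cubic_ge0 R 2 (8 / 5) x y ltac:(nra).
by nra.
Qed.

Lemma cube_sum3_le x y z : 0 <= x -> 0 <= y -> 0 <= z ->
  (x + y + z) ^+ 3 <= 4 * x ^+ 3 + 16 * y ^+ 3 + 16 * z ^+ 3.
Proof.
move=> x0 y0 z0.
have H : (x + (y + z)) ^+ 3 <= 4 * x ^+ 3 + 4 * (y + z) ^+ 3.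
  have : 0 <= (x - (y + z)) ^+ 2 * (x + (y + z)).
    by rewrite mulr_ge0 ?sqr_ge0 // !addr_ge0.
  by nra.
have : 0 <= (y - z) ^+ 2 * (y + z) by rewrite mulr_ge0 ?sqr_ge0 // addr_ge0.
by nra.
Qed.

(** [N] is at least the rank [n] of the iteration, so that the cube of 10 n r costs
    a multiple of r^3 / n only. *)
Lemma second_order_step (p l : nat) S S' r N :
  0 <= S -> 0 <= S' -> 0 <= r -> (l < p)%N -> (l = 0%N -> S' = 0) ->
  p.+1%:R <= N ->
  8 / 343 * (10 * p.+1%:R * r + S + r) ^+ 3 / N ^+ 4 + 4 * S * r ^+ 2
    + 8 / 3 * r ^+ 3 - 40 * p.+1%:R * r ^+ 3
  <= (potential p S - potential p.+1 (S + r))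
     + (potential l S' - potential l.+1 (S' + r)).
Proof.
move=> S0 S0' r0 lp l0 nN.
have p0 : p = 0%N -> S = 0 by move=> pz; rewrite pz in lp.
have r3 : 0 <= r ^+ 3 by apply: exprn_ge0.
have S3 : 0 <= S ^+ 3 by apply: exprn_ge0.
have W := second_order_window p S r S0 r0 p0.
have W' := next_window l S' r S0' r0 l0.
have n2 : 2 <= p.+1%:R :> R by rewrite ler_nat ltnS (leq_ltn_trans _ lp).
have ln : l.+1%:R * r ^+ 3 <= p.+1%:R * r ^+ 3.
  by rewrite ler_wpM2r // ler_nat ltnS ltnW.
have nr : 2 * r ^+ 3 <= p.+1%:R * r ^+ 3 by rewrite ler_wpM2r.
move: nN W W' n2 ln nr; set n := p.+1%:R; set m := l.+1%:R => nN W W' n2 ln nr.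
clearbody n m.
have n0 : 0 < n by apply: lt_le_trans n2.
have C : 8 / 343 * (10 * n * r + S + r) ^+ 3 / N ^+ 4
    <= 61 / 4 * n * r ^+ 3 + 21 / 400 * S ^+ 3 / n ^+ 2.
  have n4 : 0 < n ^+ 4 by apply: exprn_gt0.
  have nN4 : n ^+ 4 <= N ^+ 4 by apply: lerXn2r; rewrite ?nnegrE; lra.
  have X0 : 0 <= 8 / 343 * (10 * n * r + S + r) ^+ 3.
    rewrite mulr_ge0 ?exprn_ge0 ?addr_ge0 ?mulr_ge0 //; lra.
  apply: (@le_trans _ _ (8 / 343 * (10 * n * r + S + r) ^+ 3 / n ^+ 4)).
    by rewrite ler_wpM2l // lef_pV2 ?posrE // (lt_le_trans n4).
  rewrite ler_pdivrMr // [X in _ <= X]mulrDl.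
  have -> : 21 / 400 * S ^+ 3 / n ^+ 2 * n ^+ 4 = 21 / 400 * S ^+ 3 * n ^+ 2.
    by field; rewrite gt_eqF.
  have X1 : (10 * n * r + S + r) ^+ 3 <= (21 / 2 * n * r + S) ^+ 3.
    rewrite lerXn2r ?nnegrE ?addr_ge0 ?mulr_ge0 //; try lra.
    have : 2 * r <= n * r by rewrite ler_wpM2r.
    by rewrite -!mulrA; set z := n * r; lra.
  have X2 := @cube_sum2_le (21 / 2 * n * r) S ltac:(rewrite !mulr_ge0 //; lra) S0.
  have n2S : 4 * S ^+ 3 <= S ^+ 3 * n ^+ 2.
    rewrite mulrC ler_wpM2l //; nra.
  have n3r : 0 <= n ^+ 3 * r ^+ 3 by rewrite mulr_ge0 // exprn_ge0 //; lra.
  have n5r : 4 * (n ^+ 3 * r ^+ 3) <= n ^+ 2 * (n ^+ 3 * r ^+ 3).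
    by rewrite ler_wpM2r //; nra.
  by nra.
move: W W' C; set X := _ / N ^+ 4; set Y := _ / n ^+ 2.
by lra.
Qed.

(** While job 0 runs, the delay is going to reach the number of iterations of the
    job, whence [N >= n + 1]; with [N = n] the inequality fails at [p = 0] for large
    [d]. *)
Lemma second_order_step0 (p : nat) S r d N :
  0 <= S -> 0 <= r -> 0 <= d -> (p = 0%N -> S = 0) -> p.+2%:R <= N ->
  8 / 343 * (10 * p.+1%:R * r + (S + d) + r) ^+ 3 / N ^+ 4
    + 4 * (S + d) * r ^+ 2 + 8 / 3 * r ^+ 3 - 40 * p.+1%:R * r ^+ 3
  <= 2 / 100 * d ^+ 3 + (potential p S - potential p.+1 (S + r)).
Proof.
move=> S0 r0 d0 p0 nN.
have r3 : 0 <= r ^+ 3 by apply: exprn_ge0.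
have S3 : 0 <= S ^+ 3 by apply: exprn_ge0.
have d3 : 0 <= d ^+ 3 by apply: exprn_ge0.
have dr2 : 0 <= d * r ^+ 2 by rewrite mulr_ge0 // exprn_ge0.
have d2r : 0 <= d ^+ 2 * r by rewrite mulr_ge0 // exprn_ge0.
have N1 : 0 < N by apply: lt_le_trans nN; rewrite ltr0n.
set n := p.+1%:R.
have n1 : 1 <= n by rewrite ler1n.
have n0 : 0 < n by lra.
have nN' : n + 1 <= N by rewrite /n natr1.
have X0 : 0 <= 8 / 343 * (10 * n * r + (S + d) + r) ^+ 3.
  by rewrite mulr_ge0 ?exprn_ge0 ?addr_ge0 ?mulr_ge0 //; lra.
have N4 : (n + 1) ^+ 4 <= N ^+ 4 by apply: lerXn2r; rewrite ?nnegrE; lra.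
have n14 : 0 < (n + 1) ^+ 4 by apply: exprn_gt0; lra.
have C : 8 / 343 * (10 * n * r + (S + d) + r) ^+ 3 / N ^+ 4
    <= 8 / 343 * (10 * n * r + (S + d) + r) ^+ 3 / (n + 1) ^+ 4.
  by rewrite ler_wpM2l // lef_pV2 ?posrE // (lt_le_trans n14).
case: p p0 @n {nN} n1 n0 nN' X0 N4 n14 C => [|p] p0 n n1 n0 nN' X0 N4 n14 C.
  rewrite (p0 erefl) /potential invr0 !divr1 mulr0 !add0r.
  move: C; rewrite (p0 erefl) /n add0r !mulr1.
  have -> : 8 / 343 * (10 * r + d + r) ^+ 3 / (1 + 1) ^+ 4 = (11 * r + d) ^+ 3 / 686.
    by field.
  set X := _ / N ^+ 4.
  have := @tangent_cubic_ge0 R (199 / 20) (173 / 10) d r ltac:(nra).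
  by nra.
have W := second_order_window p.+1 S r S0 r0 p0.
have n2 : 2 <= n by rewrite ler_nat.
rewrite -/n in W.
clearbody n.
have nr : 2 * r ^+ 3 <= n * r ^+ 3 by rewrite ler_wpM2r.
have n3 : 0 < n ^+ 3 by apply: exprn_gt0.
have B : 8 / 343 * (10 * n * r + (S + d) + r) ^+ 3 / (n + 1) ^+ 4
   <= 6 * n * r ^+ 3 + 21 / 400 * S ^+ 3 / n ^+ 2 + 52 / 10000 * d ^+ 3.
  have n43 : 9 * n ^+ 3 <= (n + 1) ^+ 4.
    have [n3'|n3'] := leP n 3.
      have : 0 <= (n ^+ 2 - 5 / 2 * n) ^+ 2 by apply: sqr_ge0.
      by nra.
    have : 0 <= n ^+ 2 * ((n - 2) * (n - 3)).
      by rewrite mulr_ge0 ?sqr_ge0 // mulr_ge0; lra.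
    by nra.
  apply: (@le_trans _ _ (8 / 343 * (10 * n * r + (S + d) + r) ^+ 3 / (9 * n ^+ 3))).
    rewrite ler_wpM2l // lef_pV2 ?posrE //; nra.
  rewrite ler_pdivrMr ?mulr_gt0 // [X in _ <= X]mulrDl [X in _ <= X + _]mulrDl.
  have -> : 21 / 400 * S ^+ 3 / n ^+ 2 * (9 * n ^+ 3) = 189 / 400 * (S ^+ 3 * n).
    by field; rewrite gt_eqF.
  have X1 : (10 * n * r + (S + d) + r) ^+ 3 <= (21 / 2 * n * r + S + d) ^+ 3.
    rewrite lerXn2r ?nnegrE ?addr_ge0 ?mulr_ge0 //; try lra.
    have : 2 * r <= n * r by rewrite ler_wpM2r.
    by rewrite -!mulrA; set z := n * r; lra.
  have X2 := @cube_sum3_le (21 / 2 * n * r) S d ltac:(rewrite !mulr_ge0 //; lra) S0 d0.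
  have nS : 2 * S ^+ 3 <= S ^+ 3 * n by rewrite mulrC ler_wpM2l.
  have n3r : 0 <= n ^+ 3 * r ^+ 3 by rewrite mulr_ge0 // exprn_ge0 //; lra.
  have n4r : 2 * (n ^+ 3 * r ^+ 3) <= n * (n ^+ 3 * r ^+ 3).
    by rewrite ler_wpM2r.
  have n3d : 8 * d ^+ 3 <= n ^+ 3 * d ^+ 3.
    by rewrite ler_wpM2r //; nra.
  by nra.
have T : 148 / 10000 * d ^+ 3 - 4 * (d * r ^+ 2) + 254 / 10 * r ^+ 3 >= 0.
  have := @tangent_cubic_ge0 R (19 / 2) 19 d r ltac:(nra).
  by nra.
have {C}B := le_trans C B.
move: W B; set X := _ / N ^+ 4; set Y := _ / n ^+ 2.
by lra.
Qed.
End StepInequalities.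

(** * Summation over the jobs *)

Section Telescoping.
Context {R : realFieldType}.
Variables (a b : nat -> nat) (r : nat -> R).
Hypothesis ab : timeline a b.
Hypothesis r_ge0 : forall j, 0 <= r j.

Definition travel (lo k : nat) : R := \sum_(lo <= j < k) r j.

(** Window [i] is opened when job [i] reads, at time [a i]. *)
Definition window_potential (i k : nat) : R :=
  potential (k - a i) (travel (a i) k).

Lemma travel_ge0 lo k : 0 <= travel lo k.
Proof. by apply: sumr_ge0 => j _. Qed.

Lemma travel_empty lo k : (k - lo = 0)%N -> travel lo k = 0.
Proof. by move=> /eqP; rewrite subn_eq0 => kl; rewrite /travel big_geq. Qed.

Lemma window_potential_ge0 i k : 0 <= window_potential i k.
Proof.
by rewrite /window_potential /potential divr_ge0 // mulr_ge0 ?exprn_ge0 ?travel_ge0.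
Qed.

Lemma window_potential_start i : window_potential i (a i) = 0.
Proof. by rewrite /window_potential /potential subnn invr0 mulr0. Qed.

Lemma window_potentialS i k : (a i <= k)%N ->
  window_potential i k.+1 = potential (k - a i).+1 (travel (a i) k + r k).
Proof. by move=> ik; rewrite /window_potential subSn // /travel big_nat_recr. Qed.

Lemma job_start_lt i : (a i < a i.+1)%N.
Proof. by case: ab => _ -> ->. Qed.

Lemma leq_job_start m : (m <= a m)%N.
Proof. by elim: m => // m IH; apply: leq_ltn_trans IH (job_start_lt m). Qed.

(** When a job ends, the active window is dropped, which is harmless as potentials
    are nonnegative, the next window becomes active, and a fresh one is opened
    with potential 0. *)
Lemma sum_le_by_windows (D : nat -> R) (T : nat) (B : R) : 0 <= B ->
  (forall k, (k < T)%N -> (k < a 1%N)%N ->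
    D k <= B + (window_potential 0 k - window_potential 0 k.+1)) ->
  (forall i k, (k < T)%N -> (a i.+1 <= k < b i.+1)%N ->
    D k <= (window_potential i k - window_potential i k.+1)
         + (window_potential i.+1 k - window_potential i.+1 k.+1)) ->
  \sum_(k < T) D k <= (a 1%N)%:R * B.
Proof.
move=> B0 D0 DS.
have first k : (k <= a 1%N)%N -> (k <= T)%N ->
    \sum_(j < k) D j + window_potential 0 k <= k%:R * B.
  elim: k => [_ _|k IH ka kT].
    case: ab => a0 _ _.
    by rewrite big_ord0 -[X in window_potential _ X]a0 window_potential_start addr0 mul0r.
  rewrite big_ord_recr /= -natr1 mulrDl mul1r.
  by have := IH (ltnW ka) (ltnW kT); have := D0 k kT ka; lra.
have later i k : (a i.+1 <= k)%N -> (k <= a i.+2)%N -> (k <= T)%N ->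
    \sum_(j < k) D j + window_potential i k + window_potential i.+1 k
      <= (a 1%N)%:R * B.
  elim: i k => [|i IHi] k ik; rewrite -(subnKC ik); move: (k - _)%N => m {ik k};
    elim: m => [|m IH].
  - rewrite addn0 window_potential_start addr0 => _; exact: first.
  - rewrite addnS => ma mT; rewrite big_ord_recr /=.
    have := IH (ltnW ma) (ltnW mT).
    have := DS 0%N _ mT; rewrite leq_addr; case: ab => _ <- _ => /(_ ma); lra.
  - rewrite addn0 window_potential_start addr0 => _ iT.
    have := IHi (a i.+2) (ltnW (job_start_lt _)) (leqnn _) iT.
    by have := window_potential_ge0 i (a i.+2); lra.
  - rewrite addnS => ma mT; rewrite big_ord_recr /=.
    have := IH (ltnW ma) (ltnW mT).
    have := DS i.+1 _ mT; rewrite leq_addr; case: ab => _ <- _ => /(_ ma); lra.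
have all i k : (k <= a i.+1)%N -> (k <= T)%N -> \sum_(j < k) D j <= (a 1%N)%:R * B.
  elim: i => [|i IH] ki kT.
    have := first k ki kT; have := window_potential_ge0 0 k.
    have : k%:R * B <= (a 1%N)%:R * B by rewrite ler_wpM2r // ler_nat.
    by lra.
  case: (leqP k (a i.+1)) => [/IH|ik]; first exact.
  have := later i k (ltnW ik) ki kT.
  by have := window_potential_ge0 i k; have := window_potential_ge0 i.+1 k; lra.
apply: (all T T _ (leqnn T)).
exact: leq_trans (leq_job_start T) (ltnW (job_start_lt T)).
Qed.
End Telescoping.

Lemma exists_le_mean {R : realFieldType} (u : nat -> R) (T : nat) (M : R) :
  (0 < T)%N -> \sum_(k < T) u k <= M -> exists k, (k < T)%N /\ u k * T%:R <= M.
Proof.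
move=> T0 uM; apply: contrapT => no.
suff : M < \sum_(k < T) u k by rewrite ltNge uM.
have -> : M = \sum_(k < T) M / T%:R.
  by rewrite sumr_const card_ord -(mulr_natr (M / T%:R)) divfK // pnatr_eq0 -lt0n.
apply: ltr_sum => [|k _].
  by apply/hasP; exists (Ordinal T0); rewrite ?mem_index_enum.
rewrite ltr_pdivrMr ?ltr0n // ltNge; apply/negP => ukM.
by apply: no; exists k; rewrite ltn_ord.
Qed.

(** * Sampling and real powers *)

(** The probabilities of the values below [T] add up to 1, so that the function is
    almost surely a finite combination of indicators. *)
Lemma expectation_finite_law {R : realType} {disp : measure_display}
    {Omega : measurableType disp} (P : probability Omega R) (K : {RV P >-> nat})
    (T : nat) (p h : nat -> R) : (forall k, 0 <= h k) ->
  (forall k, (k < T)%N -> P (K @^-1` [set k]) = (p k)%:E) ->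
  \sum_(k < T) p k = 1 ->
  ('E_P[(fun w => h (K w))%R] = (\sum_(k < T) p k * h k)%:E)%E.
Proof.
move=> h0 Pk p1; rewrite unlock.
pose F k := K @^-1` [set k].
have mF k : measurable (F k) by exact: measurable_funPTI.
have mU : measurable (\big[setU/set0]_(k < T) F k) by exact: bigsetU_measurable.
have PU : P (\big[setU/set0]_(k < T) F k) = 1%E.
  rewrite measure_semi_additive_ord_I //.
    by rewrite (eq_bigr (fun k : 'I_T => (p k)%:E)) ?sumEFin ?p1 // => k _; exact: Pk.
  by move=> i j _ _ [w [<- <-]].
pose g (k : nat) (w : Omega) := ((h k)%:E * (\1_(F k) w)%:E)%E.
have g0 k w : (0 <= g k w)%E by rewrite mule_ge0 ?lee_fin.
have mg k : measurable_fun [set: Omega] (g k : Omega -> \bar R).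
  by apply: measurable_funeM; apply/measurable_EFinP; exact: measurable_indic.
rewrite (@ge0_ae_eq_integral _ _ _ P setT _ (fun w => \sum_(k < T) g k w)%E) //.
- rewrite ge0_integral_sum // -sumEFin; apply: eq_bigr => k _.
  rewrite /g ge0_integralZl_EFin //; last exact/measurable_EFinP/measurable_indic.
  rewrite integral_indic // setIT EFinM muleC; congr (_ * _)%E.
  exact: Pk.
- apply/measurable_EFinP.
  by apply: (@measurableT_comp _ _ _ _ _ _ h _ K).
- exact: emeasurable_sum.
- by move=> w _; rewrite lee_fin.
- by move=> w _; apply: sume_ge0.
exists (~` \big[setU/set0]_(k < T) F k); split.
- exact: measurableC.
- by have := probability_setC P mU; rewrite PU subee.
move=> w /= nfg Uw; apply: nfg => _.
have KT : (K w < T)%N.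
  by move: Uw; rewrite -bigcup_mkord => -[k /= kT ->].
rewrite (bigD1 (Ordinal KT)) //= big1 => [|k kK].
  by rewrite /g indicE mem_set // mule1 adde0.
rewrite /g indicE memNset ?mule0 // /F /= => Kwk.
by move/eqP: kK; apply; apply: val_inj.
Qed.

Section Powers.
Context {R : realType}.

Lemma powR_3half (g : R) : 0 <= g -> g `^ (3 / 2) = g * Num.sqrt g.
Proof.
move=> g0; have -> : 3 / 2 = 1 + 2^-1 :> R by field.
by rewrite powRD ?powRr1 ?powR12_sqrt //; apply/implyP => /eqP; lra.
Qed.

Lemma powR_half (g : R) : 0 <= g -> g `^ (1 / 2) = Num.sqrt g.
Proof. by move=> g0; rewrite div1r powR12_sqrt. Qed.

Lemma powR_third_cube (g : R) (m : nat) : 0 <= g -> (g `^ (m%:R / 3)) ^+ 3 = g ^+ m.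
Proof.
move=> g0; rewrite -powR_mulrn ?powR_ge0 // -powRrM divfK ?pnatr_eq0 //.
by rewrite powR_mulrn.
Qed.

Lemma weightE (tau : nat -> nat) k :
  weight tau k = (Num.sqrt (tau k).+1%:R)^-1 :> R.
Proof. by rewrite /weight powRN nat1r powR_half. Qed.

(** Jensen's inequality for the convex function 1 / sqrt, by its tangent at
    the mean. *)
Lemma sum_weight_ge (tau : nat -> nat) T : (0 < T)%N ->
  T%:R / Num.sqrt (1 + mean_delay tau T) <= \sum_(k < T) weight tau k :> R.
Proof.
move=> T0; set M : R := 1 + mean_delay tau T.
have T0' : T%:R != 0 :> R by rewrite pnatr_eq0 -lt0n.
have M0 : 0 < M.
  by rewrite ltr_pwDl // divr_ge0 // sumr_ge0.
have sM : \sum_(k < T) (tau k).+1%:R = T%:R * M :> R.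
  rewrite /M mulrDr mulr1 /mean_delay mulrC divfK //.
  under eq_bigr do rewrite -nat1r.
  by rewrite big_split /= sumr_const card_ord.
pose z := Num.sqrt M; have z0 : 0 < z by rewrite sqrtr_gt0.
have zM : M = z ^+ 2 by rewrite sqr_sqrtr // ltW.
have -> : T%:R / z = \sum_(k < T) (z^-1 * (3 / 2 - (tau k).+1%:R / (2 * M))).
  rewrite -mulr_sumr big_split /= sumr_const card_ord sumrN -mulr_suml sM.
  rewrite -(mulr_natr (3 / 2)); field.
  by rewrite gt_eqF ?gt_eqF.
apply: ler_sum => k _; rewrite weightE.
have n0 : 0 < (tau k).+1%:R :> R by rewrite ltr0n.
move: ((tau k).+1%:R : R) n0 => n n0.
pose y := Num.sqrt n; have y0 : 0 < y by rewrite sqrtr_gt0.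
have yn : n = y ^+ 2 by rewrite sqr_sqrtr // ltW.
rewrite -/y zM yn.
have D : 0 < 2 * z ^+ 3 * y by rewrite !mulr_gt0 ?exprn_gt0.
rewrite -(ler_pM2r D).
have -> : z^-1 * (3 / 2 - y ^+ 2 / (2 * z ^+ 2)) * (2 * z ^+ 3 * y)
  = 3 * z ^+ 2 * y - y ^+ 3 by field; rewrite gt_eqF.
have -> : y^-1 * (2 * z ^+ 3 * y) = 2 * z ^+ 3 by field; rewrite gt_eqF.
have : 0 <= (y - z) ^+ 2 * (y + 2 * z) by rewrite mulr_ge0 ?sqr_ge0 //; lra.
by nra.
Qed.
End Powers.

(** * The run *)

Section Run.
Context {R : realType} {d : nat}.
Variables (f : 'rV[R]_d -> R) (L fstar taumax delta0 : R) (H0 : 'M[R]_d).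
Variables (a b tau : nat -> nat) (Ht : nat -> 'M[R]_d).
Variables (x s : nat -> 'rV[R]_d) (T : nat).
Hypothesis f_diff : forall y, differentiable f y.
Hypothesis grad_diff : forall y, differentiable (gradient f) y.
Hypothesis L_gt0 : 0 < L.
Hypothesis hess_lip :
  forall y z, specnorm (hessian f y - hessian f z) <= L * enorm (y - z).
Hypothesis f_lb : forall y, fstar <= f y.
Hypothesis ab : timeline a b.
Hypothesis tauE : is_delay a b tau.
Hypothesis tau_le : forall k, (tau k)%:R <= taumax.
Hypothesis H0_sym : H0^T = H0.
Hypothesis H0_err : specnorm (H0 - hessian f (x 0%N)) <= delta0.
Hypothesis HtE : is_curvature_in_use a b f H0 x Ht.
Hypothesis run : split_client_run f Ht (fun k => 20 * L * (1 + (tau k)%:R)) T x s.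

Let r k := enorm (s k).
Let delta := delta0 / L.
Let n k : R := (tau k).+1%:R.
(* in units of L, like [delta]; [k - tau k] is the time at which the Hessian in
   use was read *)
Let err k : R := if (k < a 1%N)%N then travel r (a 0%N) k + delta
                 else travel r (k - tau k) k.
Let F0t := f (x 0%N) - fstar + (a 1%N)%:R * delta0 ^+ 3 / (20 * L) ^+ 2.
Let N := 1 + taumax.

Let r_ge0 k : 0 <= r k. Proof. exact: enorm_ge0. Qed.
Let n_ge1 k : 1 <= n k. Proof. by rewrite ler1n. Qed.
Let delta0_ge0 : 0 <= delta0. Proof. exact: le_trans (specnorm_ge0 _) H0_err. Qed.
Let delta_ge0 : 0 <= delta. Proof. by rewrite divr_ge0 // ltW. Qed.
Let a0 : a 0%N = 0%N. Proof. by case: ab. Qed.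

Lemma job_of k : (a 1%N <= k)%N -> exists i, (a i.+1 <= k < b i.+1)%N.
Proof.
have [_ aS _] := ab.
move=> ak; have ex : exists i, (a i.+1 <= k)%N by exists 0%N.
have ub i : (a i.+1 <= k)%N -> (i <= k)%N.
  apply: leq_trans.
  exact: leq_trans (leq_job_start _ _ ab i) (ltnW (job_start_lt _ _ ab i)).
have [i ik kb] := ex_maxnP ex ub.
exists i; rewrite ik /= -aS ltnNge; apply/negP => /kb.
by rewrite ltnn.
Qed.

Lemma tau_job i k : (a i.+1 <= k < b i.+1)%N -> tau k = (k - a i)%N.
Proof. exact: (proj2 tauE). Qed.

Lemma job_lo i k : (a i.+1 <= k < b i.+1)%N -> (k - tau k = a i)%N.
Proof.
move=> ik; rewrite (tau_job _ _ ik) subKn //.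
by case/andP: ik => ik _; apply: ltnW; apply: leq_trans (job_start_lt _ _ ab i) ik.
Qed.

Lemma distance_le_travel lo k : (lo <= k)%N -> (k <= T)%N ->
  enorm (x lo - x k) <= travel r lo k.
Proof.
move=> lk; rewrite -(subnKC lk); elim: (k - lo)%N => [|m IH] mT.
  by rewrite addn0 subrr enorm0 travel_ge0.
rewrite addnS in mT *.
rewrite (proj1 (run _ mT)) opprD addrA.
rewrite /travel big_nat_recr ?leq_addr //=.
by apply: le_trans (enormD _ _) _; rewrite enormN lerD2r IH // ltnW.
Qed.

Lemma err_ge0 k : 0 <= err k.
Proof. by rewrite /err; case: ifP => _; rewrite ?addr_ge0 ?travel_ge0. Qed.

Lemma curvature_error k v : (k < T)%N ->
  enorm (v *m (Ht k - hessian f (x k))) <= L * err k * enorm v.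
Proof.
move=> kT; have v0 := enorm_ge0 v.
have hx lo : (lo <= k)%N ->
    enorm (v *m (hessian f (x lo) - hessian f (x k))) <= L * travel r lo k * enorm v.
  move=> lk; apply: le_trans (specnorm_le _ _) _; rewrite ler_wpM2r //.
  by apply: le_trans (hess_lip _ _) _; rewrite ler_pM2l // distance_le_travel // ltnW.
rewrite /err; case: ifP => ka.
  rewrite (proj1 HtE) // -[X in v *m X](subrKA (hessian f (x 0%N))) mulmxDr a0.
  apply: le_trans (enormD _ _) _.
  have h0 := hx 0%N (leq0n _).
  have h1 : enorm (v *m (H0 - hessian f (x 0%N))) <= delta0 * enorm v.
    by apply: le_trans (specnorm_le _ _) _; rewrite ler_wpM2r.
  have -> : L * (travel r 0 k + delta) * enorm v
     = delta0 * enorm v + L * travel r 0 k * enorm v.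
    by rewrite /delta; field; rewrite gt_eqF.
  exact: lerD.
have [|i ik] := job_of k; first by rewrite leqNgt ka.
rewrite (proj2 HtE i k ik) (job_lo _ _ ik); apply: hx.
by rewrite -(job_lo _ _ ik) leq_subr.
Qed.

Lemma curvature_sym k : (Ht k)^T = Ht k.
Proof.
case: (ltnP k (a 1%N)) => ka; first by rewrite (proj1 HtE).
have [i ik] := job_of k ka; rewrite (proj2 HtE i k ik).
exact: (hessian_sym f L f_diff grad_diff (ltW L_gt0) hess_lip).
Qed.

Lemma run_opt k : (k < T)%N ->
  argmin (cubic_model (gradient f (x k)) (Ht k) (20 * L * n k)) (s k).
Proof. by move=> kT; have := proj2 (run _ kT); rewrite nat1r. Qed.

Lemma sum_decrease : \sum_(k < T) (f (x k) - f (x k.+1)) <= f (x 0%N) - fstar.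
Proof.
rewrite -(big_mkord xpredT (fun k => f (x k) - f (x k.+1))).
under eq_bigr do rewrite -opprB.
by rewrite sumrN telescope_sumr // opprB lerD2l lerN2.
Qed.

(** The term with [delta0] in [F0t] is what the iterations of job 0 are allowed to
    spend: L * 2 / 100 * (delta0 / L)^3 is 8 times delta0^3 / (20 L)^2. *)
Lemma sum_by_windows (Y : nat -> R) :
  (forall k, (k < a 1%N)%N -> Y k <= 2 / 100 * delta ^+ 3
     + (potential k (travel r 0 k) - potential k.+1 (travel r 0 k + r k))) ->
  (forall i k, (a i.+1 <= k < b i.+1)%N ->
     Y k <= (potential (k - a i) (travel r (a i) k)
             - potential (k - a i).+1 (travel r (a i) k + r k))
          + (potential (k - a i.+1) (travel r (a i.+1) k)
             - potential (k - a i.+1).+1 (travel r (a i.+1) k + r k))) ->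
  \sum_(k < T) (8 * (f (x k) - f (x k.+1)) + L * Y k) <= 8 * F0t.
Proof.
move=> Y0 YS; rewrite big_split /= -!mulr_sumr.
have := sum_decrease.
have : \sum_(k < T) Y k <= (a 1%N)%:R * (2 / 100 * delta ^+ 3).
  apply: (sum_le_by_windows _ _ r ab r_ge0).
  - by rewrite mulr_ge0 ?exprn_ge0 // divr_ge0.
  - move=> k _ ka; rewrite window_potentialS ?a0 //.
    by rewrite /window_potential a0 subn0; exact: Y0.
  move=> i k _ ik; have ak : (a i.+1 <= k)%N by case/andP: ik.
  have ak' : (a i <= k)%N by apply: leq_trans (ltnW (job_start_lt _ _ ab i)) ak.
  by rewrite !window_potentialS //; exact: YS.
move=> /(ler_wpM2l (ltW L_gt0)).
have -> : L * ((a 1%N)%:R * (2 / 100 * delta ^+ 3))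
   = 8 * ((a 1%N)%:R * delta0 ^+ 3 / (20 * L) ^+ 2).
  by rewrite /delta; field; rewrite gt_eqF.
by rewrite /F0t; set Z := _ / (20 * L) ^+ 2; lra.
Qed.

Lemma window_sizes i k : (a i.+1 <= k < b i.+1)%N -> (k - a i.+1 < k - a i)%N.
Proof.
case/andP => ik _; have ai := job_start_lt _ _ ab i.
by rewrite ltn_sub2l // (leq_trans ai ik).
Qed.

Lemma err_job i k : (a i.+1 <= k < b i.+1)%N -> err k = travel r (a i) k.
Proof.
move=> ik; rewrite /err (job_lo _ _ ik); case: ifP => // ka.
suff : (a 1%N <= k)%N by rewrite leqNgt ka.
case/andP: ik => ik _; apply: leq_trans ik.
by elim: i => // i IH; apply: leq_trans IH (ltnW (job_start_lt _ _ ab _)).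
Qed.

Lemma sum_gradient_power :
  \sum_(k < T) (enorm (gradient f (x k.+1)) `^ (3 / 2) * weight tau k)
    <= 8 * Num.sqrt L * F0t.
Proof.
pose Y k := 2 / 10 * (err k + r k / 2) ^+ 2 * r k / n k + 2 / 3 * r k ^+ 3
           - 6816 / 1000 * n k * r k ^+ 3.
apply: (@le_trans _ _ (\sum_(k < T) Num.sqrt L *
    (8 * (f (x k) - f (x k.+1)) + L * Y k))).
  apply: ler_sum => k _; rewrite weightE powR_3half ?enorm_ge0 //.
  rewrite (proj1 (run _ (ltn_ord k))).
  apply: (new_gradient_power f L f_diff grad_diff L_gt0 hess_lip (Ht k)) => //.
  - exact: curvature_sym.
  - exact: n_ge1.
  - exact: err_ge0.
  - by move=> v; exact: curvature_error.
  - exact: run_opt.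
rewrite -mulr_sumr mulrAC mulrC ler_wpM2r ?sqrtr_ge0 //.
apply: sum_by_windows => [k ka|i k ik]; rewrite /Y /n /err.
  rewrite ka a0 (proj1 tauE) //.
  by apply: first_order_step0; rewrite ?travel_ge0 // => ->; rewrite travel_empty.
rewrite -/(err k) (err_job _ _ ik) (tau_job _ _ ik).
apply: first_order_step; rewrite ?travel_ge0 ?window_sizes //.
exact: travel_empty.
Qed.

Lemma second_order_exists : (0 < T)%N -> exists k, (k < T)%N /\
  (L * (10 * n k * r k + err k + r k)) ^+ 3 * T%:R <= 343 * L ^+ 2 * F0t * N ^+ 4.
Proof.
move=> T0.
have N0 : 0 < N by rewrite /N ltr_pwDl // (le_trans _ (tau_le 0%N)).
pose Z k := 10 * n k * r k + err k + r k.
pose Y k := 8 / 343 * Z k ^+ 3 / N ^+ 4 + 4 * err k * r k ^+ 2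
   + 8 / 3 * r k ^+ 3 - 40 * n k * r k ^+ 3.
have sumZ : \sum_(k < T) L * (8 / 343 * Z k ^+ 3 / N ^+ 4) <= 8 * F0t.
  apply: (@le_trans _ _ (\sum_(k < T)
    (8 * (f (x k) - f (x k.+1)) + L * Y k))).
    apply: ler_sum => k _; rewrite (proj1 (run _ (ltn_ord k))).
    have := decrease_ge_cubic f L f_diff grad_diff L_gt0 hess_lip (Ht k)
      (x k) (s k) (n k) (err k) (curvature_sym k) (n_ge1 k)
      (fun v => curvature_error k v (ltn_ord k)) (run_opt k (ltn_ord k)).
    by rewrite -/(r k) /Y; set q := _ / N ^+ 4; lra.
  apply: sum_by_windows => [k ka|i k ik]; rewrite /Y /Z /n.
    rewrite /err ka a0 (proj1 tauE) //.
    apply: second_order_step0; rewrite ?travel_ge0 //; first by move=> ->; rewrite travel_empty.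
    (* the delay at the end of job 0 is [a 1], which exceeds [k] *)
    rewrite /N -addn1 natrD addrC lerD2l; apply: le_trans (tau_le (a 1%N)).
    rewrite (tau_job 0%N) ?a0 ?subn0 ?ler_nat // leqnn /=.
    by have [_ _ ab'] := ab; exact: ab'.
  rewrite (err_job _ _ ik) (tau_job _ _ ik).
  apply: second_order_step; rewrite ?travel_ge0 ?window_sizes //.
    exact: travel_empty.
  by rewrite -(tau_job _ _ ik) /N -nat1r lerD2l.
have [k [kT Hk]] := exists_le_mean (fun k => L * (8 / 343 * Z k ^+ 3 / N ^+ 4)) _ _ T0 sumZ.
exists k; split=> //; move: Hk; rewrite -/(Z k).
have N4 : 0 < N ^+ 4 by apply: exprn_gt0.
have c0 : 0 < 343 / 8 * L ^+ 2 * N ^+ 4 by rewrite !mulr_gt0 ?exprn_gt0.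
move=> /(ler_wpM2l (ltW c0)).
have -> : 343 / 8 * L ^+ 2 * N ^+ 4 * (L * (8 / 343 * Z k ^+ 3 / N ^+ 4) * T%:R)
   = (L * Z k) ^+ 3 * T%:R.
  by field; rewrite gt_eqF.
have -> // : 343 / 8 * L ^+ 2 * N ^+ 4 * (8 * F0t) = 343 * L ^+ 2 * F0t * N ^+ 4.
by field.
Qed.

(** Eigenvectors of the Hessian inherit the curvature bound of the step; the
    infimum of an empty spectrum is 0, which satisfies it too. *)
Lemma lambda_min_ge k : (k < T)%N ->
  - (L * (10 * n k * r k + err k + r k)) <= lambda_min (hessian f (x k.+1)).
Proof.
move=> kT; have Z0 : 0 <= L * (10 * n k * r k + err k + r k).
  rewrite mulr_ge0 ?(ltW L_gt0) // !addr_ge0 ?err_ge0 //.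
  by rewrite !mulr_ge0 // (le_trans ler01).
rewrite /lambda_min; have [->|ne] := eqVneq [set l | eigenvalue (hessian f (x k.+1)) l] set0.
  by rewrite inf0 oppr_le0.
apply: lb_le_inf; first exact/set0P.
move=> l /= /eigenvalueP[v vl v0].
have := new_curvature f L L_gt0 hess_lip (Ht k)
      (x k) (s k) (n k) (err k) (curvature_sym k) (n_ge1 k)
      (fun v => curvature_error k v kT) (run_opt k kT) v.
rewrite -(proj1 (run _ kT)) vl dotZl ler_pM2r // lt_neqAle dot_ge0 andbT eq_sym.
by apply: contraNneq v0 => /dot_eq0 ->.
Qed.
End Run.

Theorem theorem5 (R : realType) :
  exists C : R, C <= 7 /\
  forall (d : nat) (f : 'rV[R]_d -> R) (L fstar gamma taumax delta0 : R)
    (H0 : 'M[R]_d) (a b tau : nat -> nat) (Ht : nat -> 'M[R]_d)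
    (x s : nat -> 'rV[R]_d) (T : nat)
    (disp : measure_display) (Omega : measurableType disp)
    (P : probability Omega R) (K : {RV P >-> nat}),
  (0 < d)%N ->
  twice_continuously_differentiable f ->
  0 < L ->
  (forall y z, specnorm (hessian f y - hessian f z) <= L * enorm (y - z)) ->
  (forall y, fstar <= f y) ->
  timeline a b ->
  1 <= gamma ->
  (forall i, gamma^-1 * (duration a b i)%:R <= (duration a b i.+1)%:R
             <= gamma * (duration a b i)%:R) ->
  is_delay a b tau ->
  (forall k, (tau k)%:R <= taumax) ->
  H0^T = H0 ->
  specnorm (H0 - hessian f (x 0%N)) <= delta0 ->
  is_curvature_in_use a b f H0 x Ht ->
  (1 <= T)%N ->
  split_client_run f Ht (fun k => 20 * L * (1 + (tau k)%:R)) T x s ->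
  (forall k, (k < T)%N ->
    P (K @^-1` [set k]) = (sampling_proba tau T k)%:E) ->
  let xout := fun w : Omega => x (K w).+1 in
  let F0 := f (x 0%N) - fstar in
  let F0t := F0 + (a 1%N)%:R * delta0 ^+ 3 / (20 * L) ^+ 2 in
  ('E_P[(fun w => enorm (gradient f (xout w)) `^ (3 / 2))%R] <=
     (8 * L `^ (1 / 2) * F0t * Num.sqrt (1 + mean_delay tau T) / T%:R)%:E)%E
  /\
  exists k : nat, (k < T)%N /\
    - (C * L `^ (2 / 3) * F0t `^ (1 / 3) * (1 + taumax) `^ (4 / 3)
       / T%:R `^ (1 / 3))
    <= lambda_min (hessian f (x k.+1)).
Proof.
exists 7; split; first exact: lexx.
move=> d f L fstar gamma taumax delta0 H0 a b tau Ht x s T disp Omega P K.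
move=> _ [f_diff grad_diff _] L0 hess_lip f_lb ab _ _ tauE tau_le H0_sym H0_err.
move=> HtE T0 run PK xout F0 F0t.
have T0' : 0 < T%:R :> R by rewrite ltr0n.
split.
  pose h k := enorm (gradient f (x k.+1)) `^ (3 / 2).
  have M0 : 0 < 1 + mean_delay tau T :> R.
    by rewrite ltr_pwDl // divr_ge0 // sumr_ge0.
  have sM0 : 0 < Num.sqrt (1 + mean_delay tau T) :> R by rewrite sqrtr_gt0.
  have W := @sum_weight_ge R tau T T0.
  have W0 : 0 < \sum_(k < T) weight tau k :> R.
    by apply: lt_le_trans W; rewrite divr_gt0.
  rewrite (expectation_finite_law P K T (sampling_proba tau T) h) //.
  - rewrite lee_fin.
    have -> : \sum_(k < T) sampling_proba tau T k * h k
        = (\sum_(k < T) h k * weight tau k) / \sum_(k < T) weight tau k.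
      by rewrite mulr_suml; apply: eq_bigr => k _; rewrite mulrAC (mulrC (h k)).
    have S := sum_gradient_power f L fstar delta0 H0 a b tau Ht x s T
      f_diff grad_diff L0 hess_lip f_lb ab tauE H0_sym H0_err HtE run.
    rewrite ler_pdivrMr //; apply: (le_trans S).
    rewrite powR_half ?(ltW L0) // -/F0 -/F0t.
    have S0 : 0 <= 8 * Num.sqrt L * F0t.
      apply: le_trans S; apply: sumr_ge0 => k _.
      by rewrite mulr_ge0 ?powR_ge0.
    move: W S0; set z := Num.sqrt (1 + _) in sM0 *; set w := \sum_(k < T) _.
    move=> W S0; apply: (@le_trans _ _ (8 * Num.sqrt L * F0t * (z / T%:R * w))).
      by rewrite ler_peMr // mulrAC ler_pdivlMr // mul1r mulrC -ler_pdivrMr.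
    by rewrite !mulrA.
  - by move=> k; exact: powR_ge0.
  by rewrite -mulr_suml divff // gt_eqF.
have F00 : 0 <= F0t.
  rewrite addr_ge0 ?subr_ge0 // divr_ge0 ?sqr_ge0 // mulr_ge0 // exprn_ge0 //.
  exact: le_trans (specnorm_ge0 _) H0_err.
have [k [kT kL]] := second_order_exists f L fstar taumax delta0 H0 a b tau Ht x s T
  f_diff grad_diff L0 hess_lip f_lb ab tauE tau_le H0_sym H0_err HtE run T0.
exists k; split => //.
have lam := lambda_min_ge f L delta0 H0 a b tau Ht x s T
  f_diff grad_diff L0 hess_lip ab tauE H0_sym H0_err HtE run k kT.
apply: le_trans lam; rewrite lerN2.
have tm0 : 0 <= 1 + taumax by rewrite addr_ge0 // (le_trans _ (tau_le 0%N)).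
set B := 7 * _ * _ * _ / _.
have B0 : 0 <= B by rewrite divr_ge0 ?powR_ge0 // !mulr_ge0 ?powR_ge0.
have B3 : B ^+ 3 = 343 * L ^+ 2 * F0t * (1 + taumax) ^+ 4 / T%:R.
  rewrite /B exprMn exprVn !exprMn (powR_third_cube _ 2) ?(ltW L0) //.
  rewrite (powR_third_cube _ 1) // (powR_third_cube _ 4) // (powR_third_cube _ 1) //.
  by rewrite !expr1; congr (_ * _ * _ * _ / _); ring.
move: kL; rewrite -ler_pdivlMr // -B3; set A := L * _ => AB.
have [//|BA] := leP A B.
have : B ^+ 3 < A ^+ 3 by rewrite ltrXn2r // (le_trans B0 (ltW BA)).
by rewrite ltNge AB.
Qed.
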